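(* Fix two integers $m,n\geq 1$. Let $Q$ be an $m$-coloured quiver of mutation type $\overrightarrow{A_{n-1}}$, with vertices $1,\ldots,n-1$. If there is an arrow $i\to j$ in $Q$, let $c_{ij}$ be its colour. Define the group $B_Q$ to be generated by $s_1,\ldots,s_{n-1}$ subject to the following relations. (1) $s_is_j=s_js_i$ if there is no arrow between $i$ and $j$ (in either direction); (2) $s_is_js_i=s_js_is_j$ if there is a pair of arrows $i\rightleftarrows j$ in $Q$; (3) $s_{i_1}s_{i_2}s_{i_3}s_{i_1}=s_{i_2}s_{i_3}s_{i_1}s_{i_2}=s_{i_3}s_{i_1}s_{i_2}s_{i_3}$ if $i_1,i_2,i_3$ are three distinct vertices any two of which are joined by a pair of arrows $i_1\rightleftarrows i_2$, $i_2\rightleftarrows i_3$, $i_3\rightleftarrows i_1$ in $Q$, and $c_{i_1,i_2}+c_{i_2,i_3}+c_{i_3,i_1}=2m+1$. Then $B_Q$ is isomorphic to the braid group of type $A_{n-1}$.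
   Context: An $m$-coloured quiver $Q$ consists of a finite set of vertices and coloured arrows $i\xrightarrow{(c)}j$ with colours $c\in\{0,\ldots,m\}$. Let $q_{ij}^{(c)}$ be the number of arrows from $i$ to $j$ of colour $c$. It is required that: (I) $q_{ii}^{(c)}=0$ for all $c$; (II) $q_{ij}^{(c)}\neq 0$ implies $q_{ij}^{(c')}=0$ for all $c'\neq c$; (III) $q_{ij}^{(c)}=q_{ji}^{(m-c)}$ for all $c$. By (II) all arrows from $i$ to $j$ have the same colour, and by (III) arrows come in pairs $i\rightleftarrows j$. Mutation: for a vertex $k$ of $Q$, the mutation $\mu_k(Q)$ is the $m$-coloured quiver on the same vertices with arrow numbers $\tilde q_{ij}^{(c)}$ given by $\tilde q_{ij}^{(c)}=q_{ij}^{(c+1)}$ if $i=k$; $\tilde q_{ij}^{(c)}=q_{ij}^{(c-1)}$ if $j=k$; and, if $i\neq k\neq j$, $$\tilde q_{ij}^{(c)}=\max\Big\{0,\ q_{ij}^{(c)}-\sum_{t\neq c}q_{ij}^{(t)}+(q_{ik}^{(c)}-q_{ik}^{(c-1)})q_{kj}^{(0)}+q_{ik}^{(m)}(q_{kj}^{(c)}-q_{kj}^{(c+1)})\Big\},$$ with the conventions $q_{ij}^{(m+1)}=q_{ij}^{(0)}$ and $q_{ij}^{(-1)}=q_{ij}^{(m)}$. $\overrightarrow{A_{n-1}}$ denotes the $m$-coloured quiver on vertices $1,\ldots,n-1$ whose arrows are exactly one arrow $i\to i+1$ of colour $0$ and one arrow $i+1\to i$ of colour $m$ for each $i=1,\ldots,n-2$.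 An $m$-coloured quiver is of mutation type $\overrightarrow{A_{n-1}}$ if it equals $\mu_{i_1}\cdots\mu_{i_\ell}(\overrightarrow{A_{n-1}})$ for some $i_1,\ldots,i_\ell\in\{1,\ldots,n-1\}$ (with $\ell\ge 0$). The braid group of type $A_{n-1}$ is the group generated by $s_1,\ldots,s_{n-1}$ subject to $s_is_j=s_js_i$ for $|i-j|>1$ and $s_is_{i+1}s_i=s_{i+1}s_is_{i+1}$ for $1\le i\le n-2$. *)

(* Defs.v *)
From HB Require Import structures.
From mathcomp Require Import all_boot all_order all_algebra.
From mathcomp Require Import generic_quotient boolp.

Set Implicit Arguments.
Unset Strict Implicit.
Unset Printing Implicit Defensive.

Import Order.TTheory GRing.Theory Num.Theory.

(* A group word over I: the letter (i, true) stands for the generator s_i and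
   (i, false) for its inverse. *)
Definition gword (I : Type) := seq (I * bool).

Definition pos_word (I : Type) (s : seq I) : gword I :=
  [seq (i, true) | i <- s].

Section Presentation.
Variables (I : choiceType) (rels : gword I -> gword I -> Prop).

(* The least congruence on words that contains the relations and free
   cancellation; [rels u v] reads "u = v is a defining relation". *)
Inductive word_cong : gword I -> gword I -> Prop :=
| wc_refl u : word_cong u u
| wc_sym u v : word_cong u v -> word_cong v u
| wc_trans u v w : word_cong u v -> word_cong v w -> word_cong u w
| wc_cancel u i b v : word_cong (u ++ [:: (i, b); (i, ~~ b)] ++ v) (u ++ v)
| wc_rel u x y v : rels x y -> word_cong (u ++ x ++ v) (u ++ y ++ v).

Definition word_congb (u v : gword I) : bool := `[< word_cong u v >].

Lemma word_congb_refl : reflexive word_congb.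
Proof. by move=> u; apply/asboolP; apply: wc_refl. Qed.

Lemma word_congb_sym : symmetric word_congb.
Proof. by move=> u v; apply/asboolP/asboolP; apply: wc_sym. Qed.

Lemma word_congb_trans : transitive word_congb.
Proof.
move=> v u w /asboolP uv /asboolP vw; apply/asboolP.
exact: wc_trans uv vw.
Qed.

Canonical word_congb_equiv :=
  EquivRel word_congb word_congb_refl word_congb_sym word_congb_trans.

Lemma word_cong_ctx a b u v :
  word_cong u v -> word_cong (a ++ u ++ b) (a ++ v ++ b).
Proof.
elim=> {u v} [u|u v _ uv|u v w _ uv _ vw|u i c v|u x y v xy].
- exact: wc_refl.
- exact: wc_sym.
- exact: wc_trans uv vw.
- by have := wc_cancel (a ++ u) i c (v ++ b); rewrite -!catA.
- by have := wc_rel (a ++ u) (v ++ b) xy; rewrite -!catA.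
Qed.

Lemma word_cong_cat u u' v v' :
  word_cong u u' -> word_cong v v' -> word_cong (u ++ v) (u' ++ v').
Proof.
move=> uu vv; apply: (wc_trans (v := u' ++ v)).
  exact: (@word_cong_ctx [::] v u u' uu).
by have := word_cong_ctx u' [::] vv; rewrite !cats0.
Qed.

Definition word_inv (u : gword I) : gword I := rev [seq (x.1, ~~ x.2) | x <- u].

Lemma word_invK : involutive word_inv.
Proof.
move=> u; rewrite /word_inv map_rev revK -map_comp -[RHS]map_id.
by apply: eq_map => -[i b] /=; rewrite negbK.
Qed.

Lemma word_inv_cat u v : word_inv (u ++ v) = word_inv v ++ word_inv u.
Proof. by rewrite /word_inv map_cat rev_cat. Qed.

Lemma word_cong_mulV u : word_cong (u ++ word_inv u) [::].
Proof.
elim/last_ind: u => [|u [i b] IH]; first exact: wc_refl.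
rewrite -cats1 word_inv_cat -catA.
by apply: wc_trans IH; apply: (wc_cancel u i b).
Qed.

Lemma word_cong_Vmul u : word_cong (word_inv u ++ u) [::].
Proof. by have := word_cong_mulV (word_inv u); rewrite word_invK. Qed.

Lemma word_cong_inv u v : word_cong u v -> word_cong (word_inv u) (word_inv v).
Proof.
move=> uv; apply: (wc_trans (v := word_inv u ++ v ++ word_inv v)).
  rewrite -[X in word_cong X _]cats0.
  by apply: word_cong_cat (wc_refl _) (wc_sym (word_cong_mulV v)).
rewrite catA -[X in word_cong _ X]cat0s.
apply: word_cong_cat (wc_refl _).
apply: wc_trans (word_cong_Vmul u).
exact: word_cong_cat (wc_refl _) (wc_sym uv).
Qed.

(* The group < s_i, i in I | rels >. *)
Definition presented_group : Type := {eq_quot word_congb}%qT.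

HB.instance Definition _ := Choice.on presented_group.
HB.instance Definition _ := EqQuotient.on presented_group.

Local Open Scope quotient_scope.

Definition word_class (u : gword I) : presented_group := \pi_{eq_quot word_congb} u.

Lemma word_classP u v : word_class u = word_class v <-> word_cong u v.
Proof.
have E : (word_class u = word_class v) <-> word_congb u v.
  exact: rwP (@eqmodP _ word_congb_equiv u v).
by rewrite E; split => [/asboolP//|?]; apply/asboolP.
Qed.

Definition pg_one : presented_group := word_class [::].
Definition pg_mul (x y : presented_group) := word_class (repr x ++ repr y).
Definition pg_inv (x : presented_group) := word_class (word_inv (repr x)).

Lemma repr_class u : word_cong (repr (word_class u)) u.
Proof. by apply/word_classP; rewrite /word_class reprK. Qed.

Lemma pg_mulE u v : pg_mul (word_class u) (word_class v) = word_class (u ++ v).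
Proof. by apply/word_classP; apply: word_cong_cat; apply: repr_class. Qed.

Lemma pg_invE u : pg_inv (word_class u) = word_class (word_inv u).
Proof. by apply/word_classP; apply: word_cong_inv; apply: repr_class. Qed.

Lemma pg_surj (x : presented_group) : exists u, x = word_class u.
Proof. by exists (repr x); rewrite /word_class reprK. Qed.

Lemma pg_mulA : associative pg_mul.
Proof.
move=> x y z; have [u ->] := pg_surj x; have [v ->] := pg_surj y.
by have [w ->] := pg_surj z; rewrite !pg_mulE catA.
Qed.

Lemma pg_mul1 : left_id pg_one pg_mul.
Proof. by move=> x; have [u ->] := pg_surj x; rewrite pg_mulE. Qed.

Lemma pg_mulr1 : right_id pg_one pg_mul.
Proof. by move=> x; have [u ->] := pg_surj x; rewrite pg_mulE cats0. Qed.

Lemma pg_mulV : left_inverse pg_one pg_inv pg_mul.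
Proof.
move=> x; have [u ->] := pg_surj x; rewrite pg_invE pg_mulE.
exact/word_classP/word_cong_Vmul.
Qed.

Lemma pg_mulrV : right_inverse pg_one pg_inv pg_mul.
Proof.
move=> x; have [u ->] := pg_surj x; rewrite pg_invE pg_mulE.
exact/word_classP/word_cong_mulV.
Qed.

HB.instance Definition _ :=
  isGroup.Build presented_group pg_mulA pg_mul1 pg_mulr1 pg_mulV pg_mulrV.

End Presentation.

Definition group_isomorphic (G H : groupType) : Prop :=
  exists f : {multiplicative G -> H}, bijective f.

(* q i j c is the number of arrows from i to j of colour c. *)
Definition arrow_numbers (m : nat) (V : finType) := V -> V -> 'I_m.+1 -> nat.

Record coloured_quiver (m : nat) (V : finType) := ColouredQuiver {
  arrows :> V -> V -> 'I_m.+1 -> nat;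
  arrows_loopless : forall i c, arrows i i c = 0;
  arrows_monochrome : forall i j c c',
    arrows i j c <> 0 -> c' <> c -> arrows i j c' = 0;
  (* rev_ord c is the colour m - c. *)
  arrows_dual : forall i j c, arrows i j c = arrows j i (rev_ord c)
}.

Section Mutation.
Local Open Scope ring_scope.

(* ordS and ord_pred are the cyclic successor and predecessor on {0, ..., m}.
   The mutation is defined on arrow numbers because, for an arbitrary coloured
   quiver, the formula may violate the monochromaticity condition. *)
Definition mutation (m : nat) (V : finType) (k : V) (q : arrow_numbers m V) :
    arrow_numbers m V := fun i j c =>
  if i == k then q i j (ordS c)
  else if j == k then q i j (ord_pred c)
  else absz (Num.max 0
    ((q i j c)%:Z - \sum_(t < m.+1 | t != c) (q i j t)%:Z
     + ((q i k c)%:Z - (q i k (ord_pred c))%:Z) * (q k j ord0)%:Z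
     + (q i k ord_max)%:Z * ((q k j c)%:Z - (q k j (ordS c))%:Z))).

End Mutation.

(* The vertices 1, ..., r are encoded as 0, ..., r - 1. *)
Definition linear_arrows (m r : nat) : arrow_numbers m 'I_r := fun i j c =>
  ((j == i.+1 :> nat) && (c == ord0)) + ((i == j.+1 :> nat) && (c == ord_max)).

Definition of_mutation_type_A (m r : nat) (Q : coloured_quiver m 'I_r) : Prop :=
  exists ks : seq 'I_r, forall i j c,
    Q i j c = foldr (@mutation m 'I_r) (@linear_arrows m r) ks i j c.

Section QuiverGroup.
Variables (m : nat) (V : finType) (Q : coloured_quiver m V).

Definition has_arrow (i j : V) : bool := [exists c, Q i j c != 0].

(* The common colour of the arrows from i to j; the value 0 is a dummy when
   there is no such arrow. *)
Definition arrow_colour (i j : V) : 'I_m.+1 :=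
  odflt ord0 [pick c | Q i j c != 0].

Definition arrow_pair (i j : V) : bool := has_arrow i j && has_arrow j i.

Inductive quiver_rel : gword V -> gword V -> Prop :=
| quiver_comm i j : ~~ has_arrow i j -> ~~ has_arrow j i ->
    quiver_rel (pos_word [:: i; j]) (pos_word [:: j; i])
| quiver_braid i j : arrow_pair i j ->
    quiver_rel (pos_word [:: i; j; i]) (pos_word [:: j; i; j])
| quiver_triangle12 i1 i2 i3 : uniq [:: i1; i2; i3] ->
    arrow_pair i1 i2 -> arrow_pair i2 i3 -> arrow_pair i3 i1 ->
    arrow_colour i1 i2 + arrow_colour i2 i3 + arrow_colour i3 i1
      = (2 * m).+1 ->
    quiver_rel (pos_word [:: i1; i2; i3; i1]) (pos_word [:: i2; i3; i1; i2])
| quiver_triangle23 i1 i2 i3 : uniq [:: i1; i2; i3] ->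
    arrow_pair i1 i2 -> arrow_pair i2 i3 -> arrow_pair i3 i1 ->
    arrow_colour i1 i2 + arrow_colour i2 i3 + arrow_colour i3 i1
      = (2 * m).+1 ->
    quiver_rel (pos_word [:: i2; i3; i1; i2]) (pos_word [:: i3; i1; i2; i3]).

Definition quiver_group := presented_group quiver_rel.

HB.instance Definition _ := Group.on quiver_group.

End QuiverGroup.

(* r = n - 1 generators for the braid group of type A_(n-1). *)
Inductive braid_rel (r : nat) : gword 'I_r -> gword 'I_r -> Prop :=
| braid_comm (i j : 'I_r) : (i.+1 < j) || (j.+1 < i) ->
    braid_rel (pos_word [:: i; j]) (pos_word [:: j; i])
| braid_braid (i j : 'I_r) : j = i.+1 :> nat ->
    braid_rel (pos_word [:: i; j; i]) (pos_word [:: j; i; j]).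

Definition braid_group (r : nat) := presented_group (@braid_rel r).

HB.instance Definition _ (r : nat) := Group.on (braid_group r).

(* Main.v *)
From HB Require Import structures.
Require Import Defs.
From mathcomp Require Import all_boot all_order all_algebra zify.
From mathcomp Require Import boolp.

(** Cut a disc into (m+2)-gons along diagonals. The dual graph of the
    dissection is a planar tree: its vertices are the cells, its edges the
    diagonals, and around a cell each edge occupies one of m+2 cyclically
    ordered positions. Such a tree determines an m-coloured quiver on its
    edges, in which the colour of i -> j is the number of free or occupied
    positions strictly between i and j around their common cell. The quiver
    A_(n-1) comes from a path whose edges sit at consecutive positions, and
    quiver mutation at k is rotation of the diagonal k by one step
    ([mutation_tree]). On the tree, this moves k to the next position in both
    of its cells, and the edge that was there, if any, jumps along k to the
    position that k has left at the other end ([flip]). Hence every quiver of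
    mutation type A_(n-1) is the quiver of a planar tree.

    For the quiver of a tree, the defining relations of the group say: edges
    with no common cell commute, edges with a common cell satisfy the braid
    relation, and three edges around one cell satisfy the triangle relation
    for one of their two cyclic orders ([satisfies_tree]). This is the
    presentation of the braid group by half-twists along the edges of a planar
    tree. When k is rotated, an edge that jumps is dragged along k, so its
    half-twist should become its conjugate by s_k, while all other half-twists
    stay the same. That the conjugated family satisfies the relations of the
    flipped tree is checked directly ([slide_relations]). The reason it works
    is that, given the braid relations, the triangle relation on a, b, c says
    that b commutes with the conjugate of c by a ([tri_commuteE]), i.e. that c
    becomes disjoint from b once it is dragged along a.

    A flip is undone by rotating in the other direction, which is a flip of
    the mirror image of the tree; reflecting a tree amounts to reversing the
    multiplication of the group ([mirror_relations]). So the same computation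
    in the opposite group gives the inverse homomorphism
    ([unslide_relations]), every mutation preserves the group up to
    isomorphism ([flip_iso]), and for the path the relations are those of the
    braid group ([satisfies_braid]).

    The dissection is only used through a combinatorial property of the tree,
    the existence of cuts: for each edge, a two-colouring of the cells that
    separates the ends of this edge and of no other. It excludes loops, double
    edges and triangles ([ends_neq], [share_once], [no_cycle]) and it is
    easily carried through a flip ([flip_cuts]). *)

Set Implicit Arguments.
Unset Strict Implicit.
Unset Printing Implicit Defensive.

(** * Homomorphisms from a presented group *)

Section Evaluation.
Local Open Scope group_scope.
Variables (I : choiceType) (G : groupType).
Implicit Types (s : I -> G) (u v : gword I).

Definition letter_eval s (x : I * bool) : G :=
  if x.2 then s x.1 else (s x.1)^-1.

Definition word_eval s u : G := \prod_(x <- u) letter_eval s x.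

Lemma word_eval_cat s u v : word_eval s (u ++ v)
  = word_eval s u * word_eval s v.
Proof. exact: big_cat. Qed.

Lemma word_eval_pos s (w : seq I) : word_eval s (pos_word w) = \prod_(i <- w)
  s i.
Proof. by rewrite /word_eval big_map. Qed.

Variable rels : gword I -> gword I -> Prop.

Definition satisfies s := forall u v, rels u v -> word_eval s u = word_eval s v.

Lemma word_eval_cong s u v :
  satisfies s -> word_cong rels u v -> word_eval s u = word_eval s v.
Proof.
move=> sat; elim=> {u v} [//|u v _ ->//|u v w _ -> _ ->//|u i b v|u x y v xy].
  rewrite !word_eval_cat; congr (_ * _).
  rewrite /word_eval big_cons big_seq1 /letter_eval /=.
  by case: b; rewrite /= (mulgV, mulVg) mul1g.
by rewrite !word_eval_cat (sat _ _ xy).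
Qed.

Definition gen (i : I) : presented_group rels := word_class rels [:: (i, true)].

Lemma presented_hom s : satisfies s ->
  exists f : UMagmaMorphism.type (presented_group rels) G,
    forall i, f (gen i) = s i.
Proof.
move=> sat; pose f (x : presented_group rels) := word_eval s (repr x).
have fE u : f (word_class rels u) = word_eval s u.
  exact/word_eval_cong/repr_class.
have f1M : monoid_morphism f.
  split=> [|x y]; first by rewrite [1]/(pg_one rels) fE /word_eval big_nil.
  have [[u ->] [v ->]] := (pg_surj x, pg_surj y).
  by rewrite [_ * _]pg_mulE !fE word_eval_cat.
pose F : UMagmaMorphism.type _ _ :=
  HB.pack f (isUMagmaMorphism.Build _ _ f f1M).
by exists F => i; rewrite /= fE /word_eval big_seq1.
Qed.
End Evaluation.

Section Generators.
Local Open Scope group_scope.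
Variables (I : choiceType) (rels : gword I -> gword I -> Prop).

Lemma gen_eval (u : gword I) : word_eval (gen rels) u = word_class rels u.
Proof.
elim: u => [|[i b] u IH]; first by rewrite /word_eval big_nil.
rewrite -cat1s word_eval_cat IH -[RHS]pg_mulE; congr (_ * _).
rewrite /word_eval big_seq1 /letter_eval /=.
by case: b => //; rewrite [_^-1]pg_invE.
Qed.

Lemma gen_satisfies : satisfies rels (gen rels).
Proof.
move=> u v uv; rewrite !gen_eval; apply/word_classP.
by have := wc_rel [::] [::] uv; rewrite !cats0.
Qed.

Lemma hom_fixing_gens
    (f : UMagmaMorphism.type (presented_group rels) (presented_group rels)) :
  (forall i, f (gen rels i) = gen rels i) -> f =1 id.
Proof.
move=> fg x; have [u ->] := pg_surj x; rewrite -gen_eval.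
rewrite gmulf_prod; apply: eq_bigr => -[i b] _.
by rewrite /letter_eval /=; case: b; rewrite ?gmulfV fg.
Qed.
End Generators.

(** It is enough to check the two composites on generators: an endomorphism of
    a presented group that fixes the generators is the identity. *)
Lemma presented_iso (I J : choiceType) R1 R2
    (f : UMagmaMorphism.type (@presented_group I R1) (@presented_group J R2))
    (g : UMagmaMorphism.type (@presented_group J R2) (@presented_group I R1)) :
    (forall i, g (f (gen R1 i)) = gen R1 i) ->
    (forall j, f (g (gen R2 j)) = gen R2 j) ->
  group_isomorphic (@presented_group I R1) (@presented_group J R2).
Proof.
move=> gfK fgK; exists f; exists g => x.
  exact: (hom_fixing_gens (f := g \o f)).
exact: (hom_fixing_gens (f := f \o g)).
Qed.

Lemma group_isomorphic_trans (G H K : groupType) :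
  group_isomorphic G H -> group_isomorphic H K -> group_isomorphic G K.
Proof.
move=> [f f_bij] [g g_bij].
by exists (g \o f); apply: (bij_comp g_bij f_bij).
Qed.

(** * Braid and triangle relations in a group *)

Section BraidAlgebra.
Local Open Scope group_scope.
Variable G : groupType.
Implicit Types a b c x : G.

Definition braided a b := a * b * a = b * a * b.

(** The triangle relation, in the form that behaves well under conjugation and
    rotation of the triple; see [tri_commuteE]. *)
Definition tri_commute a b c := commute b (c ^ a).

Lemma braided_sym a b : braided a b -> braided b a.
Proof. by move=> ab; rewrite /braided ab. Qed.

Lemma commuteJ x a b : commute (a ^ x) (b ^ x) <-> commute a b.
Proof. by rewrite /commute -!conjMg; split=> [/conjg_inj|->]. Qed.

Lemma braidedJ x a b : braided (a ^ x) (b ^ x) <-> braided a b.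
Proof. by rewrite /braided -!conjMg; split=> [/conjg_inj|->]. Qed.

Lemma tri_commuteJ x a b c :
  tri_commute (a ^ x) (b ^ x) (c ^ x) <-> tri_commute a b c.
Proof. by rewrite /tri_commute -conjJg commuteJ. Qed.

Lemma commute_conj a b : commute a b -> a ^ b = a.
Proof. by move=> ab; rewrite conjgE ab mulKg. Qed.

(** Dragging b along a and dragging a backwards along b give the same element.
    This is what lets a conjugation by one generator be traded for a
    conjugation by a generator that commutes with all the others at hand. *)
Lemma braided_conj a b : braided a b -> b ^ a = a ^ b^-1.
Proof.
move=> ab; rewrite !conjgE invgK; apply: (mulgI a); rewrite mulVKg.
by apply: (mulIg b); rewrite !mulgA ab mulgVK.
Qed.

Lemma tri_commute_rot a b c : braided a c -> braided b c ->
  tri_commute a b c -> tri_commute b c a.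
Proof.
move=> ac bc; rewrite /tri_commute (braided_conj ac).
move=> /(commuteJ c); rewrite conjgKV (braided_conj (braided_sym bc)).
by move=> /(commuteJ b); rewrite conjgKV.
Qed.

(** In a b c a = b c a b, moving the leading a to the right across b turns it
    into b^-1 (a b c a) by the braid relation, which leaves a commutation. *)
Lemma tri_commuteE a b c : braided a b ->
  a * b * c * a = b * c * a * b <-> tri_commute a b c.
Proof.
move=> ab; rewrite /tri_commute /commute !conjgE.
have E : a * (b * (a^-1 * (c * a))) = b^-1 * (a * b * c * a).
  by apply: (mulgI b); rewrite mulVKg !mulgA -ab mulgK.
split=> H.
  by apply: (mulgI a); rewrite E H !mulgA mulVg mulgV !mul1g.
by apply: (mulgI b^-1); rewrite -E H !mulgA mulVg mulgV !mul1g.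
Qed.

End BraidAlgebra.

Section Opposite.
Local Open Scope group_scope.
Variable G : groupType.
(** Reversing the multiplication swaps the two orientations of the triangle
    relation and inverts conjugation ([opp_tri_commute], [opp_conj]). It makes
    the inverse of a flip an instance of a flip. *)
Definition opposite : Type := G.
HB.instance Definition _ := Choice.on opposite.
Definition opp_mul (x y : opposite) : opposite := (y : G) * (x : G).
Definition opp_inv (x : opposite) : opposite := (x : G)^-1.
Lemma opp_mulA : associative opp_mul.
Proof. by move=> x y z; rewrite /opp_mul mulgA. Qed.
Lemma opp_mul1 : left_id (1 : G) opp_mul. Proof. exact: mulg1. Qed.
Lemma opp_mulr1 : right_id (1 : G) opp_mul. Proof. exact: mul1g. Qed.
Lemma opp_mulV : left_inverse (1 : G) opp_inv opp_mul. Proof. exact: mulgV. Qed.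
Lemma opp_mulrV : right_inverse (1 : G) opp_inv opp_mul. Proof. exact: mulVg.
  Qed.
HB.instance Definition _ :=
  isGroup.Build opposite opp_mulA opp_mul1 opp_mulr1 opp_mulV opp_mulrV.

Definition to_opp (x : G) : opposite := x.

Lemma opp_conj (x y : G) : to_opp x ^ to_opp y = to_opp (x ^ y^-1).
Proof. by rewrite !conjgE [LHS]/(y * x * y^-1) invgK mulgA. Qed.

Lemma opp_commute (x y : G) : commute (to_opp x) (to_opp y) <-> commute x y.
Proof. by split=> H; apply: esym. Qed.

Lemma opp_braided (x y : G) : braided (to_opp x) (to_opp y) <-> braided x y.
Proof.
have -> : braided (to_opp x) (to_opp y) = (x * (y * x) = y * (x * y)) by [].
by rewrite !mulgA.
Qed.

Lemma opp_tri_commute (x y z : G) :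
  tri_commute (to_opp x) (to_opp z) (to_opp y) <-> tri_commute x y z.
Proof.
rewrite /tri_commute opp_conj opp_commute.
by split=> /commute_sym => [/(commuteJ x)|/(commuteJ x^-1)];
  rewrite ?conjgKV ?conjgK.
Qed.
End Opposite.

(** * Planar trees and flips *)

Section Config.
Variables (m : nat) (V : finType).

(** The edge i has the two ends (i, false) and (i, true); [M i b] is the slot
    of the end (i, b): a cell, and a position around this cell. *)
Definition config := V -> bool -> nat * nat.
Implicit Types (M : config) (i j k l : V) (b c d e : bool) (p q r : nat).

Definition cyc_succ p := if p == m.+1 then 0 else p.+1.

Definition next_slot (x : nat * nat) := (x.1, cyc_succ x.2).

(** The positions p, q, r are distinct and are met in this order when going
    around a cell in the decreasing direction. *)
Definition descending p q r := [|| r < q < p, p < r < q | q < p < r].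

Definition meet M i j := [exists b, exists c, (M i b).1 == (M j c).1].

(** The field [cuts] is how acyclicity enters: [chi i] two-colours the cells
    in such a way that the edge i, and no other, has ends of different
    colours. For a tree, take the two components left when i is removed. *)
Record planar_tree M : Prop := PlanarTree {
  slot_bound : forall i b, (M i b).2 < m.+2;
  slot_inj : forall i j b c, M i b = M j c -> i = j;
  cuts : exists chi : V -> nat -> bool, forall i j,
    chi i (M j false).1 (+) chi i (M j true).1 = (i == j)
}.

(** Rotation of the diagonal k by one step. The pivot k moves to the next slot
    in both of its cells; an edge end found there moves across k, to the slot
    that k has left in the other cell. All other ends stay. *)
Definition flip k M : config := fun i b =>
  if i == k then next_slot (M k b)
  else if M i b == next_slot (M k false) then M k true
  else if M i b == next_slot (M k true) then M k false
  else M i b.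

(** The edges that jump across k. In the quiver they are the j with an arrow k
    -> j of colour 0; see [arrow_moved0]. *)
Definition moved M k i :=
  (i != k) && [exists b, exists e, M i b == next_slot (M k e)].

Lemma meetP M i j :
  reflect (exists b c, (M i b).1 = (M j c).1) (meet M i j).
Proof.
apply: (iffP existsP) => [[b /existsP[c /eqP]]|[b [c bc]]];
  first by exists b, c.
by exists b; apply/existsP; exists c; apply/eqP.
Qed.

Lemma meetC M i j : meet M i j = meet M j i.
Proof. by apply/meetP/meetP => -[b [c bc]]; exists c, b. Qed.

Lemma movedP M k i : reflect (i <> k /\
  exists b e, M i b = next_slot (M k e)) (moved M k i).
Proof.
apply: (iffP andP) => [[/eqP ik /existsP[b /existsP[e /eqP be]]]|
    [ik [b [e be]]]].
  by split=> //; exists b, e.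
by split; [exact/eqP|apply/existsP; exists b; apply/existsP; exists e;
  apply/eqP].
Qed.

Lemma cyc_succ_neq p : cyc_succ p <> p.
Proof. by rewrite /cyc_succ; case: eqP => [->|] //; lia. Qed.

Lemma cyc_succ_bound p : p < m.+2 -> cyc_succ p < m.+2.
Proof. by rewrite /cyc_succ; case: eqP; lia. Qed.

Section Tree.
Variables (M : config) (M_tree : planar_tree M).

Lemma cuts_ends : exists chi : V -> nat -> bool, forall i j b,
  chi i (M j b).1 (+) chi i (M j (~~ b)).1 = (i == j).
Proof.
have [chi chiP] := cuts M_tree; exists chi => i j [] /=; last exact: chiP.
by rewrite addbC chiP.
Qed.

Lemma ends_neq i b c : (M i b).1 = (M i c).1 -> b = c.
Proof.
have [chi chiP] := cuts M_tree.
move: (chiP i i); rewrite eqxx => E; case: b; case: c => // bc; move: E;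
  by rewrite bc addbb.
Qed.

(** If i and j shared both cells, the cut of i would separate the ends of j. *)
Lemma share_once i j b c b' c' : i <> j ->
  (M i b).1 = (M j c).1 -> (M i b').1 = (M j c').1 -> b = b' /\ c = c'.
Proof.
move=> ij E E'; have [bb'|bb'] := eqVneq b b'.
  by split=> //; apply: (@ends_neq j); rewrite -E -E' bb'.
have [cc'|cc'] := eqVneq c c'.
  by case/eqP: bb'; apply: (@ends_neq i); rewrite E E' cc'.
have Eb : b' = ~~ b by case: b b' bb' {E E'} => [] [].
have Ec : c' = ~~ c by case: c c' cc' {E E'} => [] [].
have [chi chiP] := cuts_ends.
have := chiP i i b; have := chiP i j c.
rewrite eqxx -Eb -Ec -E -E' => ->.
by move/eqP: ij => /negPf ->.
Qed.

(** Two edges attached to different ends of k do not meet: otherwise they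
    would form a triangle with k, and the cut of k would have to separate the
    ends of one of them. *)
Lemma no_cycle i j k b c b' c' e : i <> k -> j <> k -> i <> j ->
  (M i b).1 = (M k e).1 -> (M j c).1 = (M k (~~ e)).1 ->
  (M i b').1 <> (M j c').1.
Proof.
move=> ik jk ij Ei Ej Eij; have kj : k <> j by move=> /esym.
have nbb' : b' <> b.
  move=> bb'; rewrite bb' Ei in Eij.
  by have [] := share_once kj Eij (esym Ej); case: e {Ei Ej Eij}.
have ncc' : c' <> c.
  move=> cc'; rewrite cc' Ej in Eij.
  by have [_] := share_once ik Ei Eij; case: e {Ei Ej Eij}.
have Eb : b' = ~~ b by case: b b' nbb' {Ei Eij} => [] [].
have Ec : c' = ~~ c by case: c c' ncc' {Ej Eij} => [] [].
have [chi chiP] := cuts_ends.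
have := chiP k i b; have := chiP k j c; have := chiP k k e.
rewrite eqxx -Eb -Ec -Ei -Ej Eij (introF eqP (nesym ik)) (introF eqP kj).
by case: (chi k _); case: (chi k _); case: (chi k _).
Qed.
End Tree.

Section Flip.
Variables (M : config) (M_tree : planar_tree M) (k : V).
Let N := flip k M.

Lemma flip_pivot b : N k b = next_slot (M k b).
Proof. by rewrite /N /flip eqxx. Qed.

Lemma flipP i b : i <> k ->
  (exists e, M i b = next_slot (M k e) /\ N i b = M k (~~ e)) \/
  ((forall e, M i b <> next_slot (M k e)) /\ N i b = M i b).
Proof.
move=> /eqP/negPf ik; rewrite /N /flip ik.
case: eqP => [E|nf]; first by left; exists false.
by case: eqP => [E|nt]; [left; exists true|right; split=> // -[]].
Qed.

Lemma flip_stay i b : i <> k -> ~~ moved M k i -> N i b = M i b.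
Proof.
move=> ik /movedP im; have [[e [E _]]|[]//] := flipP b ik.
by case: im; split=> //; exists b, e.
Qed.

Lemma flip_bound i b : (N i b).2 < m.+2.
Proof.
have [->|/eqP ik] := eqVneq i k.
  by rewrite flip_pivot /=; apply/cyc_succ_bound/slot_bound.
by case: (flipP b ik) => [[e [_ ->]]|[_ ->]]; apply: slot_bound.
Qed.

Lemma next_slot_neq e e' : next_slot (M k e) <> M k e'.
Proof.
move=> E; have ee' : e = e' by apply: (ends_neq M_tree (i := k)); rewrite -E.
by move: E; rewrite ee' => /(congr1 snd) /cyc_succ_neq.
Qed.

Lemma flip_inj i j b c : N i b = N j c -> i = j.
Proof.
have pivot i' b' c' : N k b' = N i' c' -> i' = k.
  have [//|/eqP ik] := eqVneq i' k; rewrite flip_pivot.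
  case: (flipP c' ik) => [[e [_ ->]]/next_slot_neq//|[nE ->] E].
  by case: (nE b').
move=> E; have [ik|/eqP ik] := eqVneq i k.
  by rewrite ik in E *; rewrite (pivot _ _ _ E).
have [jk|/eqP jk] := eqVneq j k.
  by rewrite jk in E *; rewrite (pivot _ _ _ (esym E)).
move: E; case: (flipP b ik) => [[e [Ei ->]]|[_ ->]];
  case: (flipP c jk) => [[e' [Ej ->]]|[_ ->]] E.
- have ee' : ~~ e = ~~ e' by apply: (ends_neq M_tree (i := k)); rewrite E.
  by apply: (slot_inj M_tree (b := b) (c := c));
    rewrite Ei Ej -[e]negbK ee' negbK.
- by case: jk; apply: (slot_inj M_tree (esym E)).
- by case: ik; apply: (slot_inj M_tree E).
- exact: (slot_inj M_tree E).
Qed.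

Lemma moved_end i : moved M k i -> exists b e,
  [/\ M i b = next_slot (M k e), N i b = M k (~~ e) & N i (~~ b) = M i (~~ b)].
Proof.
move=> /movedP[ik [b [e E]]]; exists b, e.
have once c e' : M i c = next_slot (M k e') -> b = c /\ e = e'.
  by move=> E'; apply: (share_once M_tree ik); rewrite ?E ?E'.
split=> //.
  by case: (flipP b ik) => [[e' [/once[_ <-]]]|[/(_ e)]].
case: (flipP (~~ b) ik) => [[e' [/once[bb]]]|[]//].
by case: b bb {E once}.
Qed.

(** View the cells of an edge as the sum of two basis vectors over the field
    with two elements. A flip adds the vector of k to those of the moved
    edges, so the dual family of cuts changes only at k, where the cuts of all
    moved edges are added. *)
Lemma flip_cuts : exists chi : V -> nat -> bool, forall i j,
  chi i (N j false).1 (+) chi i (N j true).1 = (i == j).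
Proof.
have [chi chiP] := cuts_ends M_tree.
pose chi' i C := if i == k then
  chi k C (+) \big[addb/false]_(x | moved M k x) chi x C else chi i C.
suff chi'P j b : forall i, chi' i (N j b).1 (+)
  chi' i (N j (~~ b)).1 = (i == j).
  by exists chi' => i j; apply: chi'P false i.
have chiN j' i : chi i (N j' b).1 (+) chi i (N j' (~~ b)).1 =
    (i == j') (+) (moved M k j' && (i == k)).
  have [jm|jm] /= := boolP (moved M k j').
    have [b' [e [E E' E'']]] := moved_end jm.
    have := chiP i j' b'; have := chiP i k e.
    have -> : chi i (N j' b).1 (+) chi i (N j' (~~ b)).1 =
      chi i (N j' b').1 (+) chi i (N j' (~~ b')).1.
      by case: (b) (b') => [] []; rewrite //= addbC.
    rewrite E E' E'' /= => <- <-.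
    by case: (chi i _); case: (chi i _); case: (chi i _).
  rewrite addbF; have [->|/eqP jk] := eqVneq j' k.
    by rewrite !flip_pivot /=; apply: chiP.
  by rewrite !flip_stay // chiP.
move=> i; rewrite /chi'; have [->|ik] := eqVneq i k; last first.
  by rewrite chiN (negPf ik) andbF addbF.
rewrite addbACA -big_split /= chiN eqxx andbT.
rewrite (eq_bigr (fun x => x == j)); last first.
  move=> x /andP[xk _]; rewrite chiN (negPf xk) andbF addbF //.
rewrite -[RHS]addbF -addbA; congr (_ (+) _).
have [jm|jm] := boolP (moved M k j).
  rewrite (bigD1 j) //= eqxx big1 // => x /andP[_ /negPf //].
rewrite big1 // => x xm; apply: contraNF jm => /eqP <- //.
Qed.

Lemma flip_tree : planar_tree N.
Proof. by split; [exact: flip_bound|exact: flip_inj|exact: flip_cuts]. Qed.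

Lemma meet_slots A i j b c : (A i b).1 = (A j c).1 -> meet A i j.
Proof. by move=> E; apply/meetP; exists b, c. Qed.

Lemma moved_meet i : moved M k i -> meet M i k.
Proof. by move=> /movedP[_ [b [e E]]]; apply: (@meet_slots _ _ _ b e);
  rewrite E. Qed.

Lemma moved_neq i : moved M k i -> i <> k.
Proof. by case/movedP. Qed.

Lemma meet_pivot j : meet N k j = meet M k j.
Proof.
have [->|/eqP jk] := eqVneq j k.
  by apply/meetP/meetP; exists true, true.
apply/meetP/meetP => [[b [c]]|[b [c]]].
  rewrite !flip_pivot /=; case: (flipP c jk) => [[e [E ->]]|[_ ->]] bc.
    by exists e, c; rewrite E.
  by exists b, c.
move=> bc; case: (flipP c jk) => [[e [E E']]|[_ E']].
  by exists (~~ e), c; rewrite !flip_pivot E'.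
by exists b, c; rewrite !flip_pivot E'.
Qed.

Lemma flip_stay_meet i j : i <> k -> j <> k -> ~~ moved M k i ->
  ~~ moved M k j ->
  meet N i j = meet M i j.
Proof.
move=> ik jk im jm.
by apply/meetP/meetP => -[b [c bc]]; exists b, c; move: bc;
  rewrite !flip_stay.
Qed.

(** A moved edge i meets an edge j that is away from k only through the end of
    i that does not jump. *)
Lemma flip_far i j b c : moved M k i -> ~~ meet M j k ->
  (M i b).1 = (M j c).1 \/ (N i b).1 = (N j c).1 ->
  N i b = M i b /\ N j c = M j c.
Proof.
move=> im jk E0.
have jk' : j <> k.
  by move=> E; case/negP: jk; rewrite E; apply: (@meet_slots _ _ _ true true).
have jm : ~~ moved M k j by apply: contra jk => /moved_meet.
have Nj : N j c = M j c by exact: flip_stay.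
have [b' [e [E E' E'']]] := moved_end im.
split=> //; case: (eqVneq b b') => [bb|]; last first.
  by move=> bb; have -> : b = ~~ b' by [case: b b' bb {E E' E'' E0} => [] []].
case/negP: jk; rewrite meetC; move: E0; rewrite bb E E' Nj.
by case=> [Ej|Ej]; [apply: (@meet_slots _ _ _ e c)|apply: (@meet_slots _ _ _
  (~~ e) c)].
Qed.

Lemma flip_far_meet i j : moved M k i -> ~~ meet M j k ->
  meet N i j = meet M i j.
Proof.
move=> im jk; apply/meetP/meetP => -[b [c E]]; exists b, c.
  by have [<- <-] := flip_far im jk (or_intror E).
by have [-> ->] := flip_far im jk (or_introl E).
Qed.

(** The edges that met i around its old cell are left behind. *)
Lemma moved_same_end i j b c e : j <> k -> ~~ moved M k j ->
  M i b = next_slot (M k e) -> moved M k i -> (M j c).1 = (M k e).1 ->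
    ~~ meet N i j.
Proof.
move=> jk jm E im Ej; have ik := moved_neq im.
have Nj : N j c = M j c by exact: flip_stay.
have [b' [e' [F F' _]]] := moved_end im.
have [bb ee] : b = b' /\ e = e' by apply: (share_once M_tree ik); rewrite ?E ?F.
have ij : i <> j by move=> ij; rewrite ij in im; rewrite im in jm.
apply/meetP => -[b1 [c1 bc]].
have EkN : (N j c).1 = (N k e).1 by rewrite Nj flip_pivot.
apply: (no_cycle flip_tree (k := k) jk ik (nesym ij) EkN _ (esym bc)).
by rewrite flip_pivot /= ee -F'.
Qed.

(** The edges around the cell that i enters did not meet i before. *)
Lemma moved_other_end i j b c e : j <> k -> ~~ moved M k j ->
  M i b = next_slot (M k e) -> moved M k i -> (M j c).1 = (M k (~~ e)).1 ->
  ~~ meet M i j.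
Proof.
move=> jk jm E im Ej; have ik := moved_neq im.
have ij : i <> j by move=> ij; rewrite ij in im; rewrite im in jm.
apply/meetP => -[b1 [c1 bc]]; move: bc.
by apply: (no_cycle M_tree (k := k) ik jk ij _ Ej (b := b)); rewrite E.
Qed.

(** Two moved edges come from the two ends of k, and they exchange sides. *)
Lemma moved_pair i j : i <> j -> moved M k i -> moved M k j ->
  ~~ meet M i j /\ ~~ meet N i j.
Proof.
move=> ij im jm; have ik := moved_neq im; have jk := moved_neq jm.
have [b [e [E E' _]]] := moved_end im.
have [c [e' [F F' _]]] := moved_end jm.
have ee' : e' = ~~ e.
  case: e e' E F {E' F'} => [] [] // E F; case: ij;
  by apply: (slot_inj M_tree (b := b) (c := c)); rewrite E F.
rewrite {}ee' in F F'; split; apply/meetP => -[b' [c' bc]]; move: bc.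
  by apply: (no_cycle M_tree (k := k) (e := e) (b := b) (c := c));
    rewrite ?E ?F.
apply: (no_cycle flip_tree (k := k) (e := ~~ e) (b := b) (c := c)) => //.
  by rewrite flip_pivot /= -E'.
by rewrite flip_pivot /= -F'.
Qed.

Lemma pos_neq i b j c : i <> j -> (M i b).1 = (M j c).1 ->
  (M i b).2 <> (M j c).2.
Proof.
move=> ij E E'; apply: ij; apply: (slot_inj M_tree (b := b) (c := c)).
by rewrite [LHS]surjective_pairing E E' -surjective_pairing.
Qed.

End Flip.
End Config.

(** * Dragging half-twists along a flip *)

Section Relations.
Local Open Scope group_scope.
Variables (m : nat) (V : finType).
Implicit Types (i j k l : V) (b c d e : bool) (p q r : nat).

(** The presentation of the braid group attached to a planar tree. The field
    [tree_tri] is about three edges around one cell in one of the two cyclic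
    orders. *)
Record tree_relations (G : groupType) (M : config V) (s : V ->
  G) : Prop := TreeRelations {
  tree_far : forall i j, ~~ meet M i j -> commute (s i) (s j);
  tree_near : forall i j, meet M i j -> braided (s i) (s j);
  tree_tri : forall i j l b c d,
    (M i b).1 = (M j c).1 -> (M i b).1 = (M l d).1 ->
    descending (M i b).2 (M j c).2 (M l d).2 -> tri_commute (s i) (s j) (s l)
}.

(** The effect of a flip on half-twists: those that jump are dragged along k. *)
Definition slide (G : groupType) (M : config V) k (s : V -> G) i :=
  if moved m M k i then s i ^ s k else s i.

Section Forward.
Variables (G : groupType) (M : config V) (M_tree : planar_tree m M) (k : V).
Variables (s : V -> G) (s_rel : tree_relations M s).
Local Notation N := (flip m k M).
Local Notation t := (slide M k s).

Lemma slide_pivot : t k = s k.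
Proof. by rewrite /slide /moved eqxx. Qed.

Lemma slide_moved i : moved m M k i -> t i = s i ^ s k.
Proof. by rewrite /slide => ->. Qed.

Lemma slide_stay i : ~~ moved m M k i -> t i = s i.
Proof. by rewrite /slide => /negPf ->. Qed.

Lemma slide_far i : ~~ meet M i k -> t i = s i ^ s k.
Proof.
move=> ik; rewrite slide_stay; last by apply: contra ik => /moved_meet.
by rewrite (commute_conj (tree_far s_rel ik)).
Qed.

(** The relation required of the dragged family for two edges of the flipped
    tree, in one formula so that symmetry in i and j halves the case analysis. *)
Definition pair_relation i j :=
  if meet N i j then braided (t i) (t j) else commute (t i) (t j).

Lemma pair_relationC i j : pair_relation i j -> pair_relation j i.
Proof.
rewrite /pair_relation meetC; case: ifP => _; first exact: braided_sym.
exact: commute_sym.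
Qed.

Lemma pair_relation_pivot j : pair_relation k j.
Proof.
rewrite /pair_relation meet_pivot slide_pivot.
have kk : s k = s k ^ s k by rewrite commute_conj.
case: ifP => kj.
  have br := tree_near s_rel kj.
  rewrite /slide; case: ifP => // _.
  by rewrite {1}kk; apply/braidedJ.
rewrite slide_stay; first by apply: (tree_far s_rel); rewrite kj.
by apply: contraFN kj => /moved_meet; rewrite meetC.
Qed.

Lemma pair_relation_stay i j : i <> k -> j <> k ->
  ~~ moved m M k i -> ~~ moved m M k j -> pair_relation i j.
Proof.
move=> ik jk im jm.
rewrite /pair_relation flip_stay_meet // !slide_stay //.
by case: ifP => [/(tree_near s_rel)//|/negbT/(tree_far s_rel)].
Qed.

(** As j commutes with the pivot, the whole pair is conjugated by s k. *)
Lemma pair_relation_moved_far i j :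
  moved m M k i -> ~~ meet M j k -> pair_relation i j.
Proof.
move=> im jk.
rewrite /pair_relation flip_far_meet // slide_moved // slide_far //.
case: ifP => [/(tree_near s_rel)|/negbT/(tree_far s_rel)].
  by move/(braidedJ (s k)).
by move/(commuteJ (s k)).
Qed.

Lemma descending_succ p q : p < m.+2 -> q < m.+2 -> q <> p ->
  q <> cyc_succ m p ->
  descending p q (cyc_succ m p).
Proof. by rewrite /descending /cyc_succ; case: eqP; lia. Qed.

(** If i and j were attached to the same end of k, they separate, and the
    triangle relation of k, j, i is the commutation that is needed. If they
    were attached to different ends, i is conjugated by k, or equivalently k
    by the inverse of i; as i commutes with j, this pair is conjugate to k, j. *)
Lemma pair_relation_moved_near i j : j <> k -> ~~ moved m M k j ->
  moved m M k i -> meet M j k -> pair_relation i j.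
Proof.
move=> jk jm im /meetP[c [e' jke]].
have [b [e [E E' _]]] := moved_end M_tree im.
have ij : i <> j by move=> ij; rewrite ij in im; rewrite im in jm.
have Ei : (M i b).1 = (M k e).1 by rewrite E.
rewrite /pair_relation slide_moved // slide_stay //.
have [ee'|ee'] := eqVneq e' e.
  rewrite ee' in jke.
  rewrite (negPf (moved_same_end M_tree jk jm E im jke)).
  apply: commute_sym.
  apply: (tree_tri s_rel (b := e) (c := c) (d := b)) => //.
  have jb : (M j c).1 = (M i b).1 by rewrite Ei.
  move: (pos_neq M_tree jk jke) (pos_neq M_tree (nesym ij) jb).
  by rewrite E /=; apply: descending_succ; exact: slot_bound.
have {}ee' : e' = ~~ e by case: e e' ee' {E E' jke Ei} => [] [].
rewrite ee' in jke.
have -> : meet N i j.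
  by apply: (@meet_slots _ _ _ _ b c); rewrite E' flip_stay.
have ijM := moved_other_end M_tree jk jm E im jke.
have ki : braided (s k) (s i) by apply: (tree_near s_rel (meet_slots (esym
  Ei))).
have kj : braided (s k) (s j) by apply: (tree_near s_rel (meet_slots (esym
  jke))).
rewrite (braided_conj ki) -[s j](conjgK (s i)).
rewrite (commute_conj (commute_sym (tree_far s_rel ijM))).
exact/braidedJ.
Qed.

Lemma pair_relation_moved2 i j : i <> j ->
  moved m M k i -> moved m M k j -> pair_relation i j.
Proof.
move=> ij im jm; have [ijM /negPf ijN] := moved_pair M_tree ij im jm.
by rewrite /pair_relation ijN !slide_moved //; apply/commuteJ/(tree_far s_rel).
Qed.

Lemma slide_pair i j : pair_relation i j.
Proof.
have [->|/eqP ij] := eqVneq i j.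
  by rewrite /pair_relation; case: ifP.
have [->|/eqP ik] := eqVneq i k; first exact: pair_relation_pivot.
have [->|/eqP jk] := eqVneq j k; first exact/pair_relationC/pair_relation_pivot.
have [im|im] := boolP (moved m M k i); have [jm|jm] := boolP (moved m M k j).
- exact: pair_relation_moved2.
- have [jk'|jk'] := boolP (meet M j k); first exact: pair_relation_moved_near.
  exact: pair_relation_moved_far.
- apply: pair_relationC.
  have [ik'|ik'] := boolP (meet M i k); first exact: pair_relation_moved_near.
  exact: pair_relation_moved_far.
- exact: pair_relation_stay.
Qed.

Lemma slide_near i j : meet N i j -> braided (t i) (t j).
Proof. by move=> ij; have := slide_pair i j; rewrite /pair_relation ij. Qed.

Lemma slide_apart i j : ~~ meet N i j -> commute (t i) (t j).
Proof. by move=> /negPf ij; have := slide_pair i j; rewrite /pair_relation ij.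
  Qed.

Lemma flip_away i b : (forall e, (N i b).1 <> (M k e).1) ->
  i <> k /\ N i b = M i b.
Proof.
move=> away; have ik : i <> k.
  by move=> ik; apply: (away b); rewrite ik flip_pivot.
by case: (flipP m M b ik) => [[e [_ E]]|[_ E]] //; case: (away (~~ e));
  rewrite E.
Qed.

(** Around a cell away from k, the presence of one moved edge makes the whole
    cell look conjugated: by acyclicity the other edges do not meet k. *)
Lemma slide_with_moved i j b c : (forall e, (M i b).1 <> (M k e).1) ->
  (M i b).1 = (M j c).1 -> moved m M k i -> t j = s j ^ s k.
Proof.
move=> away ij im; have [b' [e' [E _ _]]] := moved_end M_tree im.
have [jk|] := boolP (meet M j k); last exact: slide_far.
have [->|/eqP nij] := eqVneq j i; first exact: slide_moved.
have [b0 [e0 je]] := meetP _ _ _ jk.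
have Ei : (M i b').1 = (M k e').1 by rewrite E.
have ik : i <> k by case/movedP: im.
have njk : j <> k.
  by move=> jk'; apply: (away c); rewrite ij jk'.
have [ee|ee] := eqVneq e0 e'.
  have ij' : (M i b').1 = (M j b0).1 by rewrite Ei -ee.
  by have [bb _] := share_once M_tree (nesym nij) ij' ij; case: (away e');
    rewrite -bb.
have ee2 : e0 = ~~ e' by case: e0 e' ee {E Ei je} => [] [].
rewrite ee2 in je.
by case: (no_cycle M_tree ik njk (nesym nij) Ei je ij).
Qed.

Lemma slide_tri_away i j l b c d : (forall e, (N i b).1 <> (M k e).1) ->
  (N i b).1 = (N j c).1 -> (N i b).1 = (N l d).1 ->
  descending (N i b).2 (N j c).2 (N l d).2 -> tri_commute (t i) (t j) (t l).
Proof.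
move=> away ij il.
have [ik Ni] := flip_away away.
have [jk Nj] : j <> k /\ N j c = M j c by apply: flip_away => e; rewrite -ij.
have [lk Nl] : l <> k /\ N l d = M l d by apply: flip_away => e; rewrite -il.
move: ij il away; rewrite Ni Nj Nl => ij il away /(tree_tri s_rel ij il) tri.
suff [[-> -> ->] | [/slide_stay-> /slide_stay-> /slide_stay->]] :
    [/\ t i = s i ^ s k, t j = s j ^ s k & t l = s l ^ s k] \/
    [/\ ~~ moved m M k i, ~~ moved m M k j & ~~ moved m M k l] => //.
  exact/tri_commuteJ.
have [im|im] := boolP (moved m M k i); first left.
  by split; [|exact: slide_with_moved ij im|exact: slide_with_moved il im];
    apply: slide_moved.
have [jm|jm] := boolP (moved m M k j); first left.
  have away' e : (M j c).1 <> (M k e).1 by rewrite -ij.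
  split; [|exact: slide_moved|].
    exact: slide_with_moved away' (esym ij) jm.
  by apply: slide_with_moved away' _ jm; rewrite -ij; exact: il.
have [lm|lm] := boolP (moved m M k l); last by right.
have away' e : (M l d).1 <> (M k e).1 by rewrite -il.
left; split; [| |exact: slide_moved].
  exact: slide_with_moved away' (esym il) lm.
by apply: slide_with_moved away' _ lm; rewrite -il; exact: ij.
Qed.

Section AtEnd.
Variable e : bool.
Let a := (M k e).2.
Let unshift p := if p == cyc_succ m a then a else p.

(** Around a cell of k, the old position of k is now held by the edge that has
    jumped in from the other end of k. *)
Lemma flip_entered i b : (N i b).1 = (M k e).1 -> (N i b).2 = a ->
  [/\ i <> k, moved m M k i, (M i b).1 = (M k (~~ e)).1 & N i b = M k e].
Proof.
move=> E1 E2.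
have E : N i b = M k e by rewrite [LHS]surjective_pairing E1 E2
  -surjective_pairing.
have ik : i <> k.
  by move=> ik; move: E; rewrite ik flip_pivot => /(next_slot_neq M_tree).
case: (flipP m M b ik) => [[e' [F F']]|[_ F']].
  have ee' : ~~ e' = e by apply: (ends_neq M_tree (i := k)); rewrite -F' E.
  split=> //; last by rewrite -ee' negbK F.
  by apply/movedP; split=> //; exists b, e'.
by case: ik; apply: (slot_inj M_tree (b := b) (c := e)); rewrite -F'.
Qed.

(** All other edges were around this cell before, at the same position except
    for the pivot, which [unshift] puts back in its place. *)
Lemma flip_remained i b : (N i b).1 = (M k e).1 -> (N i b).2 <> a ->
  M i b = ((M k e).1, unshift (N i b).2) /\ t i = s i.
Proof.
move=> E1 E2; have [ik|/eqP ik] := eqVneq i k.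
  rewrite ik slide_pivot; rewrite ik flip_pivot /= in E1 *.
  have <- : b = e by apply: (ends_neq M_tree E1).
  by rewrite /unshift /a -(ends_neq M_tree E1) eqxx -surjective_pairing.
have [[e' [F F']]|[nF F']] := flipP m M b ik.
  case: E2; move: E1; rewrite F' => E1.
  by rewrite (ends_neq M_tree E1).
rewrite F' in E1 E2 *; split.
  rewrite /unshift; case: eqP => [E|_]; last by rewrite -E1 -surjective_pairing.
  by case: (nF e); rewrite [LHS]surjective_pairing E1 E.
apply: slide_stay; apply/movedP => -[_ [b' [e' F]]].
have [] := share_once M_tree ik _ E1 (b := b') (c := e'); first by rewrite F.
by move=> bb ee; apply: (nF e'); rewrite -bb.
Qed.

Lemma descending_unshift p q r : a < m.+2 -> p < m.+2 -> q < m.+2 -> r < m.+2 ->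
  p <> a -> q <> a -> r <> a -> descending p q r ->
  descending (unshift p) (unshift q) (unshift r).
Proof.
rewrite /descending /unshift /cyc_succ.
by case: (a =P m.+1) => ?; do 3 case: eqP => ?; lia.
Qed.

(** The pivot moves by one step only and overtakes none of the edges that
    remain, so their cyclic order is the old one. *)
Lemma slide_tri_remained i j l b c d :
  (N i b).1 = (M k e).1 -> (N j c).1 = (M k e).1 -> (N l d).1 = (M k e).1 ->
  (N i b).2 <> a -> (N j c).2 <> a -> (N l d).2 <> a ->
  descending (N i b).2 (N j c).2 (N l d).2 -> tri_commute (t i) (t j) (t l).
Proof.
move=> Ei Ej El ia ja la desc.
have [Mi ->] := flip_remained Ei ia.
have [Mj ->] := flip_remained Ej ja.
have [Ml ->] := flip_remained El la.
apply: (tree_tri s_rel (b := b) (c := c) (d := d)); rewrite ?Mi ?Mj ?Ml //=.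
apply: descending_unshift => //; by [exact: slot_bound|exact: flip_bound].
Qed.

(** The edge i that has jumped in takes the place of k in the cyclic order,
    and its image is that of k conjugated by the inverse of i. As i commutes
    with the old inhabitants of the cell, the triangle i, j, l is conjugate to
    k, j, l. When the pivot is itself one of the three, the triangle relation
    reduces to the commutation of i with j. *)
Lemma slide_tri_entered i j l b c d :
  (N i b).1 = (M k e).1 -> (N j c).1 = (M k e).1 -> (N l d).1 = (M k e).1 ->
  (N i b).2 = a ->
  descending (N i b).2 (N j c).2 (N l d).2 -> tri_commute (t i) (t j) (t l).
Proof.
move=> Ei Ej El ia desc.
have [ik im Mi Ni] := flip_entered Ei ia.
have ab : a < m.+2 by apply: slot_bound.
have jb : (N j c).2 < m.+2 by apply: flip_bound.
have lb : (N l d).2 < m.+2 by apply: flip_bound.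
have ja : (N j c).2 <> a by move: desc; rewrite ia /descending; lia.
have la : (N l d).2 <> a by move: desc; rewrite ia /descending; lia.
have [Mj tj] := flip_remained Ej ja.
have [Ml tl] := flip_remained El la.
have ki : braided (s k) (s i) by apply: (tree_near s_rel);
  rewrite meetC (moved_meet im).
have far x y : x <> k -> M x y = ((M k e).1, unshift (N x y).2) -> x <> i ->
    commute (s i) (s x).
  move=> xk Mx xi; apply: (tree_far s_rel); apply/meetP => -[b' [c' bc]].
  by apply: (no_cycle M_tree (k := k) (e := ~~ e) ik xk (nesym xi) Mi _ bc
    (c := y)); rewrite negbK Mx.
have not_i x y : M x y = ((M k e).1, unshift (N x y).2) -> x <> i.
  move=> Mx xi; rewrite xi in Mx.
  have Mx1 : (M i y).1 = (M k e).1 by rewrite Mx.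
  by have [_] := share_once M_tree ik Mi Mx1; case: (e).
have ji := not_i _ _ Mj; have li := not_i _ _ Ml.
have jk : j <> k.
  move=> jk; move: desc; rewrite ia jk flip_pivot /=.
  rewrite jk flip_pivot /= in Ej; rewrite (ends_neq M_tree Ej) -/a.
  by rewrite /descending /cyc_succ; case: eqP; lia.
have [lk|/eqP lk] := eqVneq l k.
  apply: tri_commute_rot.
  - by apply: slide_near; apply/meetP; exists d, c; rewrite El.
  - by apply: slide_near; apply/meetP; exists b, c; rewrite Ei.
  rewrite lk slide_pivot tj slide_moved // /tri_commute; apply/commuteJ.
  exact: far Mj ji.
rewrite slide_moved // tj tl (braided_conj ki).
rewrite -[s j](conjgK (s i)) -[s l](conjgK (s i)).
rewrite (commute_conj (commute_sym (far _ _ jk Mj ji))).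
rewrite (commute_conj (commute_sym (far _ _ lk Ml li))).
apply/tri_commuteJ.
apply: (tree_tri s_rel (b := e) (c := c) (d := d)); rewrite ?Mj ?Ml //=.
have not_succ x y : (N x y).1 = (M k e).1 -> x <> k ->
  unshift (N x y).2 = (N x y).2.
  move=> Ex xk; rewrite /unshift; case: eqP => // E; case: xk.
  apply: (flip_inj M_tree (k := k) (b := y) (c := e)).
  by rewrite flip_pivot [LHS]surjective_pairing Ex E.
by rewrite (not_succ _ _ Ej jk) (not_succ _ _ El lk) -/a -ia.
Qed.

Lemma slide_tri_at_end i j l b c d :
  (N i b).1 = (M k e).1 -> (N j c).1 = (M k e).1 -> (N l d).1 = (M k e).1 ->
  descending (N i b).2 (N j c).2 (N l d).2 -> tri_commute (t i) (t j) (t l).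
Proof.
move=> Ei Ej El desc.
have near x y b' c' : (N x b').1 = (M k e).1 -> (N y c').1 = (M k e).1 ->
    braided (t x) (t y).
  by move=> Ex Ey; apply: slide_near; apply/meetP; exists b', c'; rewrite Ex.
have rot p q r : descending p q r -> descending q r p by rewrite /descending;
  lia.
have [ia|/eqP ia] := eqVneq (N i b).2 a; first exact: slide_tri_entered desc.
have [la|/eqP la] := eqVneq (N l d).2 a.
  apply: tri_commute_rot; [exact: near El Ej|exact: near Ei Ej|].
  exact: slide_tri_entered El Ei Ej la (rot _ _ _ (rot _ _ _ desc)).
have [ja|/eqP ja] := eqVneq (N j c).2 a.
  do 2 (apply: tri_commute_rot; eauto).
  exact: slide_tri_entered Ej El Ei ja (rot _ _ _ desc).
exact: slide_tri_remained desc.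
Qed.

End AtEnd.

Lemma slide_relations : tree_relations N t.
Proof.
split=> [i j|i j|i j l b c d ij il desc].
- exact: slide_apart.
- exact: slide_near.
have [/existsP[e /eqP Ee]|away] := boolP [exists e, (N i b).1 == (M k e).1].
  by apply: slide_tri_at_end desc; rewrite -?ij -?il; exact: Ee.
apply: slide_tri_away ij il desc => e E; case/existsP: away.
by exists e; apply/eqP.
Qed.
End Forward.
End Relations.

(** * Mirror images and the inverse flip *)

Section Mirror.
Local Open Scope group_scope.
Variables (m : nat) (V : finType).
Implicit Types (M : config V) (i j k l : V) (b c d e : bool) (p q r : nat).

Definition mirror M : config V := fun i b => ((M i b).1, m.+1 - (M i b).2).

Lemma mirror_tree M : planar_tree m M -> planar_tree m (mirror M).
Proof.
move=> M_tree; split=> [i b|i j b c|]; last exact: cuts M_tree.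
  by rewrite /=; lia.
move=> [E1 E2]; apply: (slot_inj M_tree (b := b) (c := c)).
rewrite [LHS]surjective_pairing [RHS]surjective_pairing E1; congr pair.
have := slot_bound M_tree i b; have := slot_bound M_tree j c; lia.
Qed.

(** Reflection reverses the cyclic orders, hence the triangle relations. *)
Lemma mirror_relations (G : groupType) M (s : V -> G) : planar_tree m M ->
  tree_relations M s <-> tree_relations (mirror M) (fun i => to_opp (s i)).
Proof.
move=> M_tree; have bound i b : (M i b).2 < m.+2 := slot_bound M_tree i b.
have desc i j l b c d :
    descending (m.+1 - (M i b).2) (m.+1 - (M l d).2) (m.+1 - (M j c).2) =
    descending (M i b).2 (M j c).2 (M l d).2.
  have := bound i b; have := bound j c; have := bound l d.
  by rewrite /descending; lia.
split=> [] [far near tri]; split.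
- by move=> i j /far H; apply/opp_commute.
- by move=> i j /near H; apply/opp_braided.
- move=> i j l b c d /= ij il; rewrite desc => H.
  by apply/opp_tri_commute; apply: tri H.
- by move=> i j /far /opp_commute.
- by move=> i j /near /opp_braided.
- move=> i j l b c d ij il H; apply/opp_tri_commute.
  by apply: (tri _ _ _ b d c); rewrite //= desc.
Qed.

Lemma mirror_next (x : nat * nat) : x.2 < m.+2 ->
  next_slot m (x.1, m.+1 - cyc_succ m x.2) = (x.1, m.+1 - x.2).
Proof.
case: x => C p /= pb; congr pair; rewrite /cyc_succ /=.
by case: (p =P m.+1) => ?; case: eqP; lia.
Qed.

Lemma mirror_inj (x y : nat * nat) : x.2 < m.+2 -> y.2 < m.+2 ->
  (x.1, m.+1 - x.2) = (y.1, m.+1 - y.2) -> x = y.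
Proof. by case: x y => C p [D q] /= ? ? [-> ?]; congr pair; lia. Qed.

Lemma moved_mirror_flip M k i : planar_tree m M ->
  moved m (mirror (flip m k M)) k i = moved m M k i.
Proof.
move=> M_tree; have bound := slot_bound M_tree.
have N_tree := flip_tree M_tree k; have boundN := slot_bound N_tree.
have nextE e : next_slot m (mirror (flip m k M) k e) = mirror M k e.
  by rewrite /mirror flip_pivot; apply: mirror_next.
apply/movedP/movedP => -[ik [b [e E]]]; split=> //.
  move: E; rewrite nextE => /mirror_inj E.
  have {}E : flip m k M i b = M k e by apply: E.
  exists b, (~~ e).
  case: (flipP m M b ik) => [[e' [F F']]|[_ F']]; rewrite F' in E.
    by rewrite -(ends_neq M_tree (congr1 fst E)) negbK.
  by case: ik; apply: (slot_inj M_tree E).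
exists b, (~~ e); rewrite nextE /mirror.
case: (flipP m M b ik) => [[e' [F ->]]|[/(_ e)]] //.
have -> : e' = e; last by [].
by apply: (ends_neq M_tree (i := k)); move: (congr1 fst E); rewrite F.
Qed.

(** Rotating a diagonal back is rotating it forward in the mirror image. *)
Lemma flip_mirror_flip M k : planar_tree m M ->
  flip m k (mirror (flip m k M)) = mirror M.
Proof.
move=> M_tree; have bound := slot_bound M_tree.
apply/funext => i; apply/funext => b.
have nextE e : next_slot m (mirror (flip m k M) k e) = mirror M k e.
  by rewrite /mirror flip_pivot; apply: mirror_next.
have [->|/eqP ik] := eqVneq i k; first by rewrite flip_pivot nextE.
have N_tree := mirror_tree (flip_tree M_tree k).
have [im|im] := boolP (moved m M k i); last first.
  rewrite flip_stay ?moved_mirror_flip // /mirror flip_stay //.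
have im' : moved m (mirror (flip m k M)) k i by rewrite moved_mirror_flip.
have [b1 [e [E E' E'']]] := moved_end M_tree im.
have [b2 [e2 [F F' F'']]] := moved_end N_tree im'.
move: F; rewrite nextE.
have [bb|bb] := eqVneq b2 b1; last first.
  have -> : b2 = ~~ b1 by case: b1 b2 bb {E E' E'' F' F''} => [] [].
  rewrite /mirror E'' => /mirror_inj F.
  have {}F : M i (~~ b1) = M k e2 by apply: F.
  by case: ik; apply: (slot_inj M_tree F).
rewrite bb /mirror E' in F' F'' *.
move=> /(congr1 fst) /= /(ends_neq M_tree) ee.
have [->|nb] := eqVneq b b1.
  rewrite F' -ee negbK flip_pivot E //.
have -> : b = ~~ b1 by case: b b1 nb {E E' E'' F' F'' bb} => [] [].
by rewrite F'' E''.
Qed.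

(** Dragging in the opposite direction; in the opposite group this is [slide]
    for the mirror image of the flipped tree. *)
Definition unslide (G : groupType) M k (t : V -> G) i :=
  if moved m M k i then t i ^ (t k)^-1 else t i.

Lemma unslide_relations (G : groupType) M k (t : V -> G) : planar_tree m M ->
  tree_relations (flip m k M) t -> tree_relations M (unslide M k t).
Proof.
move=> M_tree; have N_tree := flip_tree M_tree k.
move=> /(mirror_relations _ N_tree) rel; apply/mirror_relations => //.
have := slide_relations (mirror_tree N_tree) k rel.
rewrite flip_mirror_flip //.
suff -> : slide m (mirror (flip m k M)) k (fun i => to_opp (t i)) =
  (fun i => to_opp (unslide M k t i)) by [].
apply/funext => i; rewrite /slide /unslide moved_mirror_flip //.
by case: ifP => // _; rewrite opp_conj.
Qed.

End Mirror.

(** * Mutation of the coloured quiver of a tree *)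

Import GRing.Theory.

Section Arrows.
Variables (m : nat) (V : finType).
Implicit Types (M : config V) (i j k l : V) (b c d e : bool) (p q r : nat).

(** The number of steps from position p to position q around a cell. The value
    for p = q is m+2. *)
Definition gap p q := if p < q then q - p else q + m.+2 - p.

(** The colour counts the positions strictly between i and j, whence the
    successor. *)
Definition arrow M i j (x : 'I_m.+1) := (i != j) &&
  [exists b, exists c,
     ((M i b).1 == (M j c).1) && (gap (M i b).2 (M j c).2 == x.+1)].

Definition tree_arrows M : arrow_numbers m V := fun i j x => arrow M i j x.

Lemma arrow_irr M i x : arrow M i i x = false.
Proof. by rewrite /arrow eqxx. Qed.

Lemma arrow_far M i j x : ~~ meet M i j -> arrow M i j x = false.
Proof.
move=> ij; apply/negbTE/negP => /andP[_ /existsP[b /existsP[c /andP[/eqP bc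
  _]]]].
by case/meetP: ij; exists b, c.
Qed.

Section Tree.
Variables (M : config V) (M_tree : planar_tree m M).

(** As two edges share at most one cell, any witness of their meeting
    determines the colour. *)
Lemma arrow_at i j b c x : i <> j -> (M i b).1 = (M j c).1 ->
  arrow M i j x = (gap (M i b).2 (M j c).2 == x.+1).
Proof.
move=> ij bc; rewrite /arrow (introF eqP ij) /=.
apply/existsP/idP => [[b' /existsP[c' /andP[/eqP bc' E]]]|E].
  by have [-> ->] := share_once M_tree ij bc bc'.
by exists b; apply/existsP; exists c; rewrite bc eqxx.
Qed.

Lemma gap_range p q : p < m.+2 -> q < m.+2 -> p <> q -> 0 < gap p q < m.+2.
Proof. by rewrite /gap; case: ifP; lia. Qed.

Lemma gapC p q : p < m.+2 -> q < m.+2 -> p <> q -> gap q p = m.+2 - gap p q.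
Proof. by rewrite /gap; case: ifP; case: ifP; lia. Qed.

Lemma gap_succ p : p < m.+2 -> gap p (cyc_succ m p) = 1.
Proof. by rewrite /gap /cyc_succ; case: (p =P m.+1) => ? *; case: ltnP; lia.
  Qed.

Lemma gap_succV p : p < m.+2 -> gap (cyc_succ m p) p = m.+1.
Proof. by rewrite /gap /cyc_succ; case: (p =P m.+1) => ? *; case: ltnP; lia.
  Qed.

Lemma gap1 p q : p < m.+2 -> q < m.+2 -> gap p q = 1 -> q = cyc_succ m p.
Proof.
by rewrite /gap /cyc_succ; case: (p =P m.+1) => ?; case: (ltnP p q) => ?; lia.
Qed.

Lemma gap_succl p q : p < m.+2 -> q < m.+2 -> q <> p -> q <> cyc_succ m p ->
  gap p q = (gap (cyc_succ m p) q).+1.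
Proof.
by rewrite /gap /cyc_succ; case: (p =P m.+1) => ? *; case: (ltnP p q) => ?;
  case: ltnP; lia.
Qed.

Lemma gap_succr p q : p < m.+2 -> q < m.+2 -> p <> q -> p <> cyc_succ m q ->
  gap p (cyc_succ m q) = (gap p q).+1.
Proof.
by rewrite /gap /cyc_succ; case: (q =P m.+1) => ? *; case: (ltnP p q) => ?;
  case: ltnP; lia.
Qed.

Lemma gap_slots i j b c : i <> j -> (M i b).1 = (M j c).1 ->
  0 < gap (M i b).2 (M j c).2 < m.+2.
Proof.
by move=> ij bc; apply: gap_range (pos_neq M_tree ij bc); apply: slot_bound.
Qed.

Lemma arrow_exists i j : i <> j -> [exists x, arrow M i j x] = meet M i j.
Proof.
move=> ij; apply/existsP/idP => [[x]|/meetP[b [c bc]]].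
  by apply: contraLR => /arrow_far->.
have := gap_slots ij bc => g.
have xb : (gap (M i b).2 (M j c).2).-1 < m.+1 by lia.
by exists (Ordinal xb); rewrite (arrow_at _ ij bc) /=; lia.
Qed.

Lemma arrow_colour_uniq i j x y : arrow M i j x -> arrow M i j y -> x = y.
Proof.
have [->|/eqP ij] := eqVneq i j; first by rewrite arrow_irr.
have [/meetP[b [c bc]]|/arrow_far->//] := boolP (meet M i j).
by rewrite !(arrow_at _ ij bc) => /eqP-> /eqP[]; apply: val_inj.
Qed.

Lemma arrow_dual i j x : arrow M i j x = arrow M j i (rev_ord x).
Proof.
have [->|/eqP ij] := eqVneq i j; first by rewrite !arrow_irr.
have [ij'|ij'] := boolP (meet M i j); last by rewrite !arrow_far // meetC.
have /meetP[b [c bc]] := ij'.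
rewrite (arrow_at _ ij bc) (arrow_at _ (nesym ij) (esym bc)).
have := gap_slots ij bc; rewrite (gapC _ _ (pos_neq M_tree ij bc));
  try exact: slot_bound.
have := ltn_ord x; move: (gap _ _) => g /= xb gb.
by apply/eqP/eqP; lia.
Qed.

Lemma arrow_moved k j x : moved m M k j -> arrow M k j x = (x == ord0).
Proof.
move=> jm; have [b [e [E _ _]]] := moved_end M_tree jm.
rewrite (arrow_at (b := e) (c := b) _ (nesym (moved_neq jm))) E //=.
by rewrite -val_eqE /= (gap_succ (slot_bound M_tree k e)) eqSS eq_sym.
Qed.

Lemma arrow_moved0 k j : j <> k -> arrow M k j ord0 = moved m M k j.
Proof.
move=> jk; have [jm|/movedP jm] := boolP (moved m M k j).
  by rewrite (arrow_moved _ jm).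
apply/negbTE/negP => /andP[_ /existsP[e /existsP[b /andP[/eqP E /eqP E']]]].
case: jm; split=> //; exists b, e; rewrite [LHS]surjective_pairing -E.
congr pair; exact: (gap1 (slot_bound M_tree k e) (slot_bound M_tree j b)).
Qed.

End Tree.

Section Mutation.
Variables (M : config V) (M_tree : planar_tree m M) (k : V).
Hypothesis m_gt0 : 0 < m.
Local Notation N := (flip m k M).
Let N_tree : planar_tree m N := flip_tree M_tree k.

Lemma ordSE (x : 'I_m.+1) : ordS x = (if x == m :> nat then 0 else x.+1) :> nat.
Proof.
by have := ltn_ord x; rewrite /=; case: eqP => [->|] *;
  rewrite ?modnn // modn_small //; lia.
Qed.

Lemma ord_predE (x : 'I_m.+1) : ord_pred x =
  (if x == 0 :> nat then m else x.-1) :> nat.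
Proof.
have := ltn_ord x; rewrite /=; case: eqP => [->|] *;
  first by rewrite add0n modn_small.
have -> : (x + m.+1).-1 = x.-1 + m.+1 by lia.
by rewrite modnDr modn_small //; lia.
Qed.

Lemma ord_eq0 (y : 'I_m.+1) : (y == ord0) = (y == 0 :> nat).
Proof. by []. Qed.

Lemma flip_arrow_pivot j x : arrow N k j x = arrow M k j (ordS x).
Proof.
have [->|/eqP jk] := eqVneq j k; first by rewrite !arrow_irr.
have kj := nesym jk; have xb := ltn_ord x.
have [kjM|kjM] := boolP (meet M k j); last by rewrite !arrow_far // meet_pivot.
have [jm|jm] := boolP (moved m M k j).
  have [b [e [E E' _]]] := moved_end M_tree jm.
  rewrite (arrow_at N_tree (b := ~~ e) (c := b) _ kj) flip_pivot E' //.
  rewrite arrow_moved // ord_eq0 ordSE.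
  rewrite (gap_succV (slot_bound M_tree k (~~ e))) eqSS.
  by case: ifP; lia.
have /meetP[e [c E]] := kjM.
rewrite (arrow_at N_tree (b := e) (c := c) _ kj) flip_pivot flip_stay //.
rewrite (arrow_at M_tree _ kj E) ordSE.
have ne := pos_neq M_tree kj E.
have ne' : (M j c).2 <> cyc_succ m (M k e).2.
  move=> E'; case/movedP: jm; split=> //; exists c, e.
  by rewrite [LHS]surjective_pairing -E E'.
have := gap_succl (slot_bound M_tree k e) (slot_bound M_tree j c) (nesym ne)
  ne'.
have := gap_range (cyc_succ_bound (slot_bound M_tree k e))
  (slot_bound M_tree j c) (nesym ne').
have := gap_slots M_tree kj E; rewrite /=; move: (gap _ _) (gap _ _) => g g'.
by case: ifP; lia.
Qed.

Lemma sum_other_arrows i j x : i <> j ->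
  (\sum_(y < m.+1 | y != x) arrow M i j y = meet M i j && ~~ arrow M i j x)%N.
Proof.
move=> ij; have [A|A] /= := boolP (arrow M i j x).
  rewrite andbF big1 // => y yx; case: (boolP (arrow M i j y)) => // B.
  by rewrite (arrow_colour_uniq M_tree B A) eqxx in yx.
rewrite andbT -arrow_exists //; case: existsP => [[y B]|nB]; last first.
  by rewrite big1 // => y _; case: (boolP (arrow M i j y)) => // B; case: nB;
    exists y.
have yx : y != x by apply: contraNneq A => <-.
rewrite (bigD1 y) //= B big1 // => z /andP[_ zy].
case: (boolP (arrow M i j z)) => // C.
by rewrite (arrow_colour_uniq M_tree C B) eqxx in zy.
Qed.

Section OffPivot.
Local Open Scope ring_scope.

(** Off the pivot, the factors with colour 0 and m in the mutation formula say
    whether i and j are moved, and the arrows of another colour than x are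
    there exactly when i and j meet with a colour different from x. *)
Lemma mutation_off i j x : i <> k -> j <> k ->
  mutation k (tree_arrows M) i j x = absz (Num.max 0
    ((arrow M i j x : nat)%:Z
     - ([&& i != j, meet M i j & ~~ arrow M i j x] : nat)%:Z
     + ((arrow M i k x : nat)%:Z - (arrow M i k (ord_pred x) : nat)%:Z)
       * (moved m M k j : nat)%:Z
     + (moved m M k i : nat)%:Z
       * ((arrow M k j x : nat)%:Z - (arrow M k j (ordS x) : nat)%:Z))).
Proof.
move=> ik jk; rewrite /mutation /tree_arrows (introF eqP ik) (introF eqP jk).
rewrite arrow_moved0 // (arrow_dual M_tree i k ord_max).
have -> : rev_ord (@ord_max m) = ord0 by apply: val_inj; rewrite /= subnn.
rewrite arrow_moved0 // -(big_morph Posz PoszD (erefl 0)).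
have [->|/eqP ij] := eqVneq i j; last by rewrite sum_other_arrows.
by rewrite big1 // => y _; rewrite arrow_irr.
Qed.

End OffPivot.

Lemma mutation_stay i j x : i <> k -> j <> k ->
  ~~ moved m M k i -> ~~ moved m M k j ->
  mutation k (tree_arrows M) i j x = arrow N i j x.
Proof.
move=> ik jk im jm; rewrite mutation_off // (negPf im) (negPf jm)
  mulr0 mul0r !addr0.
have -> : arrow N i j x = arrow M i j x.
  by rewrite /arrow; congr (_ && _); apply: eq_existsb => b;
    apply: eq_existsb => c; rewrite !flip_stay.
by case: arrow; rewrite ?andbF //= andbT; case: (_ && _).
Qed.

(** The two correction terms cancel: i and j do not meet before or after. *)
Lemma mutation_moved2 i j x :
  moved m M k i -> moved m M k j ->
  mutation k (tree_arrows M) i j x = arrow N i j x.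
Proof.
move=> im jm; rewrite (mutation_off _ (moved_neq im) (moved_neq jm)) im jm.
have [A [A' B]] : arrow M i j x = false /\ arrow N i j x = false /\
    [&& i != j, meet M i j & ~~ arrow M i j x] = false.
  have [->|/eqP ij] := eqVneq i j; first by rewrite !arrow_irr.
  by have [ijM ijN] := moved_pair M_tree ij im jm;
    rewrite !arrow_far // (negPf ijM).
rewrite B A A' !(arrow_dual M_tree i k) !arrow_moved //.
have -> : (rev_ord x == ord0) = (ordS x == ord0).
  by rewrite !ord_eq0 ordSE /=; have := ltn_ord x; case: ifP; lia.
have -> : (rev_ord (ord_pred x) == ord0) = (x == ord0).
  rewrite !ord_eq0 [rev_ord _ : nat]/(m.+1 - (ord_pred x).+1)%N ord_predE.
  by have := ltn_ord x; case: ifP; lia.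
by case: (x == _); case: (ordS x == _).
Qed.

(** If i is at the end of k that j leaves, the colour of i -> j exceeds the
    colour of i -> k by one and the corrections cancel the arrow. If i is at
    the other end, j inherits from k the arrow i -> k; here m > 0 ensures that
    its colour differs from the cyclically next one, so that the negative
    correction does not interfere. *)
Lemma mutation_moved_right i j x : i <> k ->
  ~~ moved m M k i -> moved m M k j ->
  mutation k (tree_arrows M) i j x = arrow N i j x.
Proof.
move=> ik im jm; have jk := moved_neq jm.
have ij : i <> j by move=> ij; rewrite ij jm in im.
rewrite mutation_off // (negPf im) jm mul0r mulr1 addr0 (introF eqP ij) /=.
have [b [e [E E' _]]] := moved_end M_tree jm.
have [|ikM] := boolP (meet M i k); last first.
  rewrite (arrow_far (j := k)) // (arrow_far (j := k) (ord_pred x)) // addr0.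
  have -> : arrow N i j x = arrow M i j x.
    have [|ijM] := boolP (meet M i j); last first.
      by rewrite !arrow_far // meetC flip_far_meet // meetC.
    rewrite meetC => /meetP[c [d cd]].
    have [F F'] := flip_far M_tree jm ikM (or_introl cd).
    rewrite (arrow_at N_tree (b := d) (c := c)) ?F ?F' //.
    by rewrite (arrow_at M_tree (b := d) (c := c)).
  by case: arrow; rewrite ?andbF //= andbT; case: meet.
move=> /meetP[c [e' ce]].
rewrite !(arrow_at M_tree _ ik ce) ord_predE.
have pk := pos_neq M_tree ik ce.
have [ee|ee] := eqVneq e' e.
  rewrite ee in ce pk *.
  have ijc : (M i c).1 = (M j b).1 by rewrite E.
  rewrite (arrow_far (M := N)) ?(arrow_at M_tree _ ij ijc); last first.
    by rewrite meetC; apply: (moved_same_end M_tree ik im E jm ce).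
  rewrite (meet_slots ijc).
  have := gap_slots M_tree ij ijc; have := pos_neq M_tree ij ijc.
  rewrite E /= => ne.
  rewrite (gap_succr (slot_bound M_tree i c) (slot_bound M_tree k e) pk ne).
  have := gap_slots M_tree ik ce; have := ltn_ord x.
  move: (gap _ _) => g; case: (x =P 0 :> nat); lia.
have {}ee : e' = ~~ e by case: e e' ee {E E' ce pk} => [] [].
rewrite ee in ce pk *.
have ijM : ~~ meet M i j.
  by rewrite meetC; apply: (moved_other_end M_tree ik im E jm ce).
have ijc : (N i c).1 = (N j b).1 by rewrite E' flip_stay.
rewrite (arrow_at N_tree _ ij ijc) E' flip_stay // (arrow_far x ijM)
  (negPf ijM).
have := ltn_ord x; move: (gap _ _) => g /=; case: (x =P 0 :> nat); lia.
Qed.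

Lemma ordS_rev (y : 'I_m.+1) : ordS (rev_ord y) = rev_ord (ord_pred y).
Proof.
apply: ord_inj; rewrite ordSE [RHS]/(m.+1 - (ord_pred y).+1) ord_predE /=.
by have := ltn_ord y; case: ifP; case: ifP; lia.
Qed.

Lemma ord_pred_rev (y : 'I_m.+1) : ord_pred (rev_ord y) = rev_ord (ordS y).
Proof. by rewrite -[y in RHS]rev_ordK ordS_rev !rev_ordK. Qed.

(** The mutation formula is compatible with reversing arrows, so it is enough
    to treat a moved target. *)
Lemma mutation_dual i j x :
  mutation k (tree_arrows M) i j x = mutation k (tree_arrows M) j i (rev_ord x).
Proof.
have dual := arrow_dual M_tree.
have [->|/eqP ik] := eqVneq i k; have [->|/eqP jk] := eqVneq j k.
- by rewrite /mutation eqxx /tree_arrows !arrow_irr.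
- rewrite /mutation eqxx (introF eqP jk) /tree_arrows.
  by rewrite dual ord_pred_rev.
- rewrite /mutation eqxx (introF eqP ik) /tree_arrows.
  by rewrite dual ordS_rev.
rewrite !mutation_off // ord_pred_rev ordS_rev -!dual [j == i]eq_sym meetC.
congr (absz (Num.max _ _)).
by rewrite -!addrA; do 2 congr (_ + _)%R;
  rewrite addrC mulrC [X in (_ + X)%R]mulrC.
Qed.

Lemma mutation_tree i j x :
  mutation k (tree_arrows M) i j x = tree_arrows N i j x.
Proof.
have [->|/eqP ik] := eqVneq i k.
  by rewrite /mutation eqxx /tree_arrows flip_arrow_pivot.
have [->|/eqP jk] := eqVneq j k.
  rewrite mutation_dual /mutation eqxx /tree_arrows -flip_arrow_pivot.
  by rewrite -arrow_dual.
have [im|im] := boolP (moved m M k i); have [jm|jm] := boolP (moved m M k j).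
- exact: mutation_moved2.
- by rewrite mutation_dual mutation_moved_right // /tree_arrows (arrow_dual
  N_tree i j).
- exact: mutation_moved_right.
- exact: mutation_stay.
Qed.

End Mutation.
End Arrows.

(** * The group of the quiver of a tree *)

Section TreeQuiver.
Local Open Scope group_scope.
Variables (m : nat) (V : finType) (M : config V) (M_tree : planar_tree m M).
Implicit Types (i j k l : V) (b c d e : bool).

Fact tree_arrows_loopless i (x : 'I_m.+1) : tree_arrows M i i x = 0.
Proof. by rewrite /tree_arrows arrow_irr. Qed.

Fact tree_arrows_monochrome i j (x y : 'I_m.+1) :
  tree_arrows M i j x <> 0 -> y <> x -> tree_arrows M i j y = 0.
Proof.
rewrite /tree_arrows; case: (boolP (arrow M i j x)) => // A _ yx.
by case: (boolP (arrow M i j y)) => // B; case: yx;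
  exact: arrow_colour_uniq B A.
Qed.

Fact tree_arrows_dual i j (x : 'I_m.+1) :
  tree_arrows M i j x = tree_arrows M j i (rev_ord x).
Proof. by rewrite /tree_arrows (arrow_dual M_tree). Qed.

Definition tree_quiver : coloured_quiver m V :=
  ColouredQuiver tree_arrows_loopless tree_arrows_monochrome tree_arrows_dual.

Lemma has_arrowE i j : has_arrow tree_quiver i j = (i != j) && meet M i j.
Proof.
have [<-|/eqP ij] := eqVneq i j.
  by apply/existsP => -[x]; rewrite /= /tree_arrows arrow_irr.
rewrite -(arrow_exists M_tree ij); apply: eq_existsb => x.
by rewrite /= /tree_arrows; case: arrow.
Qed.

Lemma arrow_pairE i j : arrow_pair tree_quiver i j = (i != j) && meet M i j.
Proof. by rewrite /arrow_pair !has_arrowE meetC [j == i]eq_sym andbb. Qed.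

Lemma arrow_colourE i j b c : i <> j -> (M i b).1 = (M j c).1 ->
  (arrow_colour tree_quiver i j).+1 = gap m (M i b).2 (M j c).2.
Proof.
move=> ij bc; rewrite /arrow_colour; case: pickP => [x|no].
  rewrite /= /tree_arrows (arrow_at M_tree _ ij bc).
  by case: (gap _ _ _ =P x.+1) => [->|].
have /existsP[x] : [exists x, arrow (m := m) M i j x].
  by rewrite (arrow_exists M_tree ij) (meet_slots bc).
by move=> A; have := no x; rewrite /= /tree_arrows A.
Qed.

(** Going once around a cell adds up to m+2 steps, in the descending order to
    twice as many. In terms of colours the latter is the condition 2m+1. *)
Lemma descending_gap p q r : p < m.+2 -> q < m.+2 -> r < m.+2 ->
  p <> q -> q <> r -> r <> p ->
  descending p q r <-> gap m p q + gap m q r + gap m r p = (2 * m.+2)%N.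
Proof.
move=> *; rewrite /descending /gap.
by case: (ltnP p q) => ?; case: (ltnP q r) => ?; case: (ltnP r p) => ?; lia.
Qed.

(** Three edges that meet pairwise share a cell, for otherwise they would form
    a cycle. *)
Lemma triangle_cell i1 i2 i3 : i1 <> i2 -> i2 <> i3 -> i3 <> i1 ->
  meet M i1 i2 -> meet M i2 i3 -> meet M i3 i1 ->
  exists b c d, (M i1 b).1 = (M i2 c).1 /\ (M i1 b).1 = (M i3 d).1.
Proof.
move=> n12 n23 n31 /meetP[b [c bc]] /meetP[c' [d cd]] /meetP[d' [b' db]].
exists b, c, d; split=> //; rewrite bc.
have [<-//|ncc] := eqVneq c' c.
have cc : c' = ~~ c by case: c c' ncc {bc cd} => [] [].
rewrite cc in cd.
by case: (no_cycle M_tree n12 (nesym n23) (nesym n31) bc (esym cd) (esym db)).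
Qed.

Lemma triangle_tri (G : groupType) (s : V -> G) i1 i2 i3 :
  tree_relations M s ->
  arrow_pair tree_quiver i1 i2 -> arrow_pair tree_quiver i2 i3 ->
  arrow_pair tree_quiver i3 i1 ->
  arrow_colour tree_quiver i1 i2 + arrow_colour tree_quiver i2 i3 +
    arrow_colour tree_quiver i3 i1 = (2 * m).+1%N ->
  tri_commute (s i1) (s i2) (s i3).
Proof.
move=> [_ _ tri]; rewrite !arrow_pairE.
move=> /andP[/eqP n12 m12] /andP[/eqP n23 m23] /andP[/eqP n31 m31].
have [b [c [d [bc bd]]]] := triangle_cell n12 n23 n31 m12 m23 m31.
have cd : (M i2 c).1 = (M i3 d).1 by rewrite -bc.
have := arrow_colourE n12 bc; have := arrow_colourE n23 cd.
have := arrow_colourE n31 (esym bd) => c31 c23 c12 sum.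
apply: (tri _ _ _ _ _ _ bc bd); apply/descending_gap;
  try exact: (slot_bound M_tree).
- exact: (pos_neq M_tree n12 bc).
- exact: (pos_neq M_tree n23 cd).
- exact: (pos_neq M_tree n31 (esym bd)).
by rewrite -c12 -c23 -c31; lia.
Qed.

(** Given the braid relations, the two equations of a triangle are the same
    commutation for two rotations of it, so a single field suffices. *)
Lemma satisfies_tree (G : groupType) (s : V -> G) :
  satisfies (quiver_rel tree_quiver) s <-> tree_relations M s.
Proof.
split=> [sat|rel].
  have near i j : meet M i j -> braided (s i) (s j).
    have [->//|ij ijM] := eqVneq i j.
    have := sat _ _ (@quiver_braid _ _ tree_quiver i j _).
    by rewrite !word_eval_pos !big_cons !big_nil !mulg1 !mulgA; apply;
      rewrite arrow_pairE ij.
  split=> // [i j ijM|i j l b c d ij il desc].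
    have [<-//|ij] := eqVneq i j.
    have := sat _ _ (@quiver_comm _ _ tree_quiver i j _ _).
    rewrite !word_eval_pos !big_cons !big_nil !mulg1; apply; rewrite has_arrowE.
      by rewrite negb_and ijM orbT.
    by rewrite negb_and meetC ijM orbT.
  have neq x y b' c' : (M x b').1 = (M y c').1 -> (M x b').2 <> (M y c').2 ->
    x <> y.
    move=> xy + xy'; rewrite xy' in xy *.
    by rewrite (ends_neq M_tree xy).
  have jl : (M j c).1 = (M l d).1 by rewrite -ij.
  have nij : i <> j by apply: neq ij _; move: desc; rewrite /descending; lia.
  have njl : j <> l by apply: neq jl _; move: desc; rewrite /descending; lia.
  have nli : l <> i by apply: neq (esym il) _; move: desc; rewrite /descending;
    lia.
  apply/tri_commuteE; first by apply: near; apply: meet_slots ij.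
  have := sat _ _ (@quiver_triangle12 _ _ tree_quiver i j l _ _ _ _ _).
  rewrite !word_eval_pos !big_cons !big_nil !mulg1 !mulgA; apply.
  - by rewrite /= !inE !negb_or; do !(apply/andP; split) => //;
    apply/eqP => //; exact: nesym.
  - by rewrite arrow_pairE (meet_slots ij) andbT; apply/eqP.
  - by rewrite arrow_pairE (meet_slots jl) andbT; apply/eqP.
  - by rewrite arrow_pairE (meet_slots (esym il)) andbT; apply/eqP.
  have := arrow_colourE nij ij; have := arrow_colourE njl jl.
  have := arrow_colourE nli (esym il).
  have bound x y : (M x y).2 < m.+2 := slot_bound M_tree x y.
  have [+ _] := descending_gap (bound i b) (bound j c) (bound l d)
    (pos_neq M_tree nij ij) (pos_neq M_tree njl jl)
    (pos_neq M_tree nli (esym il)).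
  by move/(_ desc); lia.
move=> u v; case=> {u v}.
- move=> i j; rewrite has_arrowE negb_and negbK => ij _.
  rewrite !word_eval_pos !big_cons !big_nil !mulg1; case/orP: ij => [/eqP->//|].
  exact: tree_far.
- move=> i j; rewrite arrow_pairE => /andP[_ ij].
  by rewrite !word_eval_pos !big_cons !big_nil !mulg1 !mulgA;
    apply: tree_near ij.
- move=> i j l _ ij jl li sum; rewrite !word_eval_pos !big_cons !big_nil !mulg1
  !mulgA.
  apply/tri_commuteE; last exact: triangle_tri ij jl li sum.
  by apply: (tree_near rel); move: ij; rewrite arrow_pairE => /andP[].
- move=> i j l _ ij jl li sum; rewrite !word_eval_pos !big_cons !big_nil !mulg1
  !mulgA.
  have near x y : arrow_pair tree_quiver x y -> braided (s x) (s y).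
    by rewrite arrow_pairE => /andP[_]; apply: tree_near.
  apply/tri_commuteE; first exact: near.
  by apply: tri_commute_rot; [exact/braided_sym/near|exact: near|
     exact: triangle_tri ij jl li sum].
Qed.

End TreeQuiver.

Section Step.
Variables (m : nat) (V : finType) (M : config V) (M_tree : planar_tree m M)
  (k : V).
Let N_tree := flip_tree M_tree k.

(** On generators, [unslide] and [slide] are conjugation by inverse elements
    because both leave the pivot unchanged. *)
Lemma flip_iso : group_isomorphic
  (presented_group (quiver_rel (tree_quiver N_tree)))
  (presented_group (quiver_rel (tree_quiver M_tree))).
Proof.
set R := quiver_rel (tree_quiver M_tree);
  set R' := quiver_rel (tree_quiver N_tree).
have kM : moved m M k k = false by rewrite /moved eqxx.
have /satisfies_tree rel : satisfies R (gen R) by apply: gen_satisfies.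
have /satisfies_tree rel' : satisfies R' (gen R') by apply: gen_satisfies.
have [f fE] : exists f : UMagmaMorphism.type (presented_group R')
  (presented_group R),
    forall i, f (gen R' i) = slide m M k (gen R) i.
  by apply/presented_hom/satisfies_tree/slide_relations.
have [g gE] : exists g : UMagmaMorphism.type (presented_group R)
  (presented_group R'),
    forall i, g (gen R i) = unslide m M k (gen R') i.
  by apply/presented_hom/satisfies_tree/unslide_relations.
apply: (presented_iso (f := f) (g := g)) => i.
  rewrite fE /slide; case: ifP => im; rewrite ?gmulfJ !gE /unslide ?im ?kM //.
  by rewrite conjgKV.
rewrite gE /unslide; case: ifP => im;
  rewrite ?gmulfJ ?gmulfV !fE /slide ?im ?kM //.
by rewrite conjgK.
Qed.
End Step.

Section Linear.
Variables (m r : nat).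

(** The path on the cells 0, ..., r: the edge i joins the cells i and i+1, and
    in a cell the edge that arrives is one position before the edge that
    leaves. *)
Definition linear_config : config 'I_r :=
  fun i b => if b then (i.+1, 0) else (i : nat, 1).

Lemma linear_tree : planar_tree m linear_config.
Proof.
split=> [i []//|i j [] [] //= [] ij|].
- exact: val_inj.
- exact: val_inj.
exists (fun (i : 'I_r) C => C <= i) => i j /=; rewrite -val_eqE /=; lia.
Qed.

Lemma linear_tree_arrows i j (x : 'I_m.+1) :
  tree_arrows linear_config i j x = linear_arrows i j x.
Proof.
have ex2 (P : pred bool) : [exists b, P b] = P true || P false.
  apply/existsP/orP => [[[]]|[]]; by [left|right|exists true|exists false].
rewrite /tree_arrows /arrow ex2 !ex2 /linear_arrows /= /gap /= -!val_eqE /=.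
have := ltn_ord x; lia.
Qed.

Lemma linear_meet (i j : 'I_r) : meet linear_config i j = (i <= j.+1)
  && (j <= i.+1).
Proof.
have ex2 (P : pred bool) : [exists b, P b] = P true || P false.
  apply/existsP/orP => [[[]]|[]]; by [left|right|exists true|exists false].
by rewrite /meet ex2 !ex2 /=; lia.
Qed.

(** A cell of the path has only two edges, so there are no triangles. *)
Lemma satisfies_braid (G : groupType) (s : 'I_r -> G) :
  satisfies (@braid_rel r) s <-> tree_relations linear_config s.
Proof.
split=> [sat|[far near _] u v].
  have next (i j : 'I_r) : j = i.+1 :> nat -> braided (s i) (s j).
    move=> ij; have := sat _ _ (@braid_braid _ i j ij).
    by rewrite !word_eval_pos !big_cons !big_nil !mulg1 !mulgA.
  split=> [i j|i j|i j l b c d].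
  - rewrite linear_meet => ij; have := sat _ _ (@braid_comm _ i j _).
    by rewrite !word_eval_pos !big_cons !big_nil !mulg1; apply; lia.
  - rewrite linear_meet => ij; have [ij'|ij'|/val_inj->//] := ltngtP i j.
      by apply: next; lia.
    by apply/braided_sym/next; lia.
  - by case: b; case: c; case: d; rewrite /descending.
case=> {u v} i j ij; rewrite !word_eval_pos !big_cons !big_nil !mulg1.
  by apply: far; rewrite linear_meet; lia.
by rewrite !mulgA; apply: near; rewrite linear_meet; lia.
Qed.

Lemma linear_iso : group_isomorphic
  (presented_group (quiver_rel (tree_quiver linear_tree))) (braid_group r).
Proof.
set R := quiver_rel _.
have [f fE] : exists f : UMagmaMorphism.type
    (presented_group R) (presented_group (@braid_rel r)),
    forall i, f (gen R i) = gen (@braid_rel r) i.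
  exact/presented_hom/satisfies_tree/satisfies_braid/gen_satisfies.
have [g gE] : exists g : UMagmaMorphism.type
    (presented_group (@braid_rel r)) (presented_group R),
    forall i, g (gen (@braid_rel r) i) = gen R i.
  by apply/presented_hom/satisfies_braid/(satisfies_tree linear_tree)/
    gen_satisfies.
by apply: (presented_iso (f := f) (g := g)) => i; rewrite ?(fE, gE).
Qed.
End Linear.

Lemma coloured_quiver_eq m V (Q Q' : coloured_quiver m V) :
  (forall i j c, Q i j c = Q' i j c) -> Q = Q'.
Proof.
case: Q Q' => a p q r [a' p' q' r'] /= E.
have {}E : a = a' by apply/funext => i; apply/funext => j; apply/funext => c.
by case: _ / E p' q' r' => p' q' r'; congr ColouredQuiver;
  apply: Prop_irrelevance.
Qed.

Theorem theorem1p1 (m n : nat) (m_ge1 : 1 <= m) (n_ge1 : 1 <= n)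
    (Q : coloured_quiver m 'I_n.-1) (Q_type_A : of_mutation_type_A Q) :
  group_isomorphic (quiver_group Q) (braid_group n.-1).
Proof.
have [ks Qks] := Q_type_A.
suff [M [M_tree [arrowsE iso]]] : exists M (M_tree : planar_tree m M),
    (forall i j c, tree_arrows M i j c =
      foldr (@mutation m 'I_n.-1) (@linear_arrows m n.-1) ks i j c) /\
    group_isomorphic (presented_group (quiver_rel (tree_quiver M_tree)))
      (braid_group n.-1).
  have -> : Q = tree_quiver M_tree.
    by apply: coloured_quiver_eq => i j c; rewrite Qks -arrowsE.
  exact: iso.
elim: ks {Q Q_type_A Qks} => [|k ks [M [M_tree [arrowsE iso]]]].
  exists (linear_config (r := n.-1)), (linear_tree m n.-1); split;
    last exact: linear_iso.
  exact: linear_tree_arrows.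
exists (flip m k M), (flip_tree M_tree k); split=> [i j c|].
  rewrite -mutation_tree //=.
  by congr mutation; apply/funext => i'; apply/funext => j'; apply/funext => c'.
exact: group_isomorphic_trans (flip_iso M_tree k) iso.
Qed.
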